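(* Let $n\ge r\ge1$ and let $\mathcal{V}^0_{n,r}$ be the set of pointed vector configurations in $\mathbf{R}^{r\times n}$ in general position. Let $(\mathfrak{F}^*_{n,r})^0:=\operatorname{aff}\{f^*(V):V\in\mathcal{V}^0_{n,r}\}$. Then $\dim(\mathfrak{F}^*_{n,r})^0=\lfloor\frac{r-1}{2}\rfloor\lfloor\frac{n-r+1}{2}\rfloor$ and $$(\mathfrak{F}^*_{n,r})^0=f^*(V_0)+S(\mathfrak{G}^0_{n,r})$$ for any $V_0\in\mathcal{V}^0_{n,r}$, where $\mathfrak{G}^0_{n,r}$ is the space of real matrices $g=[g_{j,k}]_{0\le j\le r,0\le k\le n-r}$ satisfying $g_{j,k}=-g_{r-j,k}=-g_{j,n-r-k}=g_{r-j,n-r-k}$ for all $j,k$ and $g_{0,k}=0$ for all $k$, and $S=S_{n,r}$ is the injective linear map sending such a matrix $g$ to the matrix whose $(s,t)$ entry is the coefficient of $x^{n-s}y^t$ in $-\sum_{j,k}g_{j,k}(x+y)^k(x+1)^{n-r-k}y^j$.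
   Context: $[n]=\{1,\dots,n\}$. A vector configuration is a matrix $V=[v_1|\cdots|v_n]\in\mathbf{R}^{r\times n}$; it is in general position if any $r$ columns are linearly independent, and pointed if all columns lie in an open linear halfspace $\{x:\langle u,x\rangle>0\}$ for some $u\ne0$. For $F\in\{-1,0,+1\}^n$ let $F_+,F_0,F_-$ be the sets of $i$ with $F_i=+1,0,-1$. $\mathcal{F}^*(V)$ is the set of sign vectors $(\operatorname{sgn}\lambda_1,\dots,\operatorname{sgn}\lambda_n)$ over all nontrivial linear dependencies $\sum_i\lambda_iv_i=0$. The $f^*$-matrix $f^*(V)=[f^*_{s,t}(V)]$ has entries $f^*_{s,t}(V)=|\{F\in\mathcal{F}^*(V):|F_-|=t,|F_+|=s-t\}|$ (indices $0\le s\le n$, $0\le t\le n$). *)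

(* Defs.v *)
From HB Require Import structures.
From mathcomp Require Import all_boot all_order all_algebra.
From mathcomp Require Import boolp reals.

Set Implicit Arguments.
Unset Strict Implicit.
Unset Printing Implicit Defensive.

Import Order.TTheory GRing.Theory Num.Theory.
Local Open Scope ring_scope.

Section Defs.
Variable R : realType.

Definition general_position (r n : nat) (V : 'M[R]_(r, n)) : Prop :=
  forall f : 'I_r -> 'I_n, injective f -> \det (colsub f V) != 0.

Definition pointed (r n : nat) (V : 'M[R]_(r, n)) : Prop :=
  exists u : 'I_r -> R, (exists j, u j != 0) /\
    forall i : 'I_n, 0 < \sum_(j < r) u j * V j i.

Definition config0 (r n : nat) (V : 'M[R]_(r, n)) : Prop :=
  pointed V /\ general_position V.

(* A sign vector F in {-1,0,+1}^n is encoded by the pair (F_+, F_-) of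
   disjoint subsets of [n].  It belongs to F^*(V) iff it is the sign vector of
   some nontrivial linear dependency lambda (V *m lambda = 0, lambda <> 0). *)
Definition in_Fstar (r n : nat) (V : 'M[R]_(r, n))
    (F : {set 'I_n} * {set 'I_n}) : Prop :=
  exists lam : 'cV[R]_n, lam != 0 /\ V *m lam = 0 /\
    F.1 = [set i | 0 < lam i 0] /\ F.2 = [set i | lam i 0 < 0].

Definition fstar_entry (r n : nat) (V : 'M[R]_(r, n)) (s t : nat) : nat :=
  #|[set F : {set 'I_n} * {set 'I_n} |
      `[< in_Fstar V F >] && (#|F.2| == t) && (#|F.1| + t == s)%N]|.

Definition fstar (r n : nat) (V : 'M[R]_(r, n)) : 'M[R]_(n.+1, n.+1) :=
  \matrix_(s < n.+1, t < n.+1) (fstar_entry V s t)%:R.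

Definition aff_hull (m p : nat) (X : 'M[R]_(m, p) -> Prop) : 'M[R]_(m, p) -> Prop :=
  fun A => exists (k : nat) (P : 'I_k -> 'M[R]_(m, p)) (c : 'I_k -> R),
    (forall i, X (P i)) /\ \sum_(i < k) c i = 1 /\ A = \sum_(i < k) c i *: P i.

Definition aff_dim (m p : nat) (Y : 'M[R]_(m, p) -> Prop) (d : nat) : Prop :=
  (exists (A0 : 'M[R]_(m, p)) (B : d.-tuple 'M[R]_(m, p)),
      Y A0 /\ (forall b, b \in B -> Y (A0 + b)) /\ free B) /\
  (forall (A0 : 'M[R]_(m, p)) (B : seq 'M[R]_(m, p)),
      Y A0 -> (forall b, b \in B -> Y (A0 + b)) -> free B -> (size B <= d)%N).

Definition fstar_set (r n : nat) : 'M[R]_(n.+1, n.+1) -> Prop :=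
  fun A => exists V : 'M[R]_(r, n), config0 V /\ A = fstar V.

Definition G0 (r n : nat) (g : 'M[R]_(r.+1, (n - r).+1)) : Prop :=
  (forall j k, g j k = - g (rev_ord j) k /\ g j k = - g j (rev_ord k) /\
               g j k = g (rev_ord j) (rev_ord k)) /\
  (forall k, g ord0 k = 0).

(* The bivariate polynomial -sum_{j,k} g_{j,k} (x+y)^k (x+1)^{n-r-k} y^j,
   as an element of {poly {poly R}}: outer variable y = 'X, inner x = 'X%:P. *)
Definition S_poly (r n : nat) (g : 'M[R]_(r.+1, (n - r).+1)) : {poly {poly R}} :=
  - \sum_(j < r.+1) \sum_(k < (n - r).+1)
      ((g j k)%:P%:P * ('X%:P + 'X) ^+ k * (('X + 1)%:P) ^+ (n - r - k)
       * 'X ^+ j).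

Definition S_map (r n : nat) (g : 'M[R]_(r.+1, (n - r).+1)) : 'M[R]_(n.+1, n.+1) :=
  \matrix_(s < n.+1, t < n.+1) ((S_poly g)`_t)`_(n - s).

End Defs.

(* Main.v *)
Require Import Defs.
From HB Require Import structures.
From mathcomp Require Import all_boot all_order all_algebra.
From mathcomp Require Import boolp reals.
From mathcomp Require Import ring lra zify.
Import Order.TTheory GRing.Theory Num.Theory.
Local Open Scope ring_scope.

(* Let E_V(x,y,z) be the sum over F in F^*(V) of x^|F_0| y^|F_-| z^|F_+|, so that
   f^*(V) lists the coefficients of E_V(x,y,1), and put a = x+y, b = x+z, m = n-r.

   Inclusion.  In general position F^*(V) is the face poset of a simple hyperplane
   arrangement in the m-dimensional space of dependencies.  Euler's relation for its
   relatively open cones shows that the part of E_V of total degree at most m in (a, b)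
   does not depend on V.  Also every F has fewer than m zeros.  Hence, for two
   configurations, D = E_V - E_W is a combination of monomials
   a^p d^(m-p) y^q d^(r-q) with d = a - b = y - z, that is, of the products
   a^k b^(m-k) y^j z^(r-j).  The coefficients g are unique, and their symmetries are
   those of D: antipodality gives E(x,z,y) = E(x,y,z), Euler's relation for closed cones
   gives E(-x-y-z,y,z) = (-1)^(m+1) E(x,y,z), and pointedness gives E(x,0,z) = 0.

   Span.  Take r vectors in a hyperplane H whose unique dependency has j negative signs,
   add generic vectors, k on one side of H and m - k on the other, and push one of the r
   vectors off H to either side.  The two resulting configurations differ by one
   mutation, and the difference of their f^*-matrices is S(g) for g the
   antisymmetrization of the unit matrix at (j,k).  These matrices span G^0. *)

Set Implicit Arguments.
Unset Strict Implicit.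

(** * Signs of real numbers *)

Section Signs.
Variable R : realType.

(* [None] encodes the sign 0, [Some true] the sign + and [Some false] the sign -. *)
Definition osg (a : R) : option bool := if a == 0 then None else Some (0 < a).

Lemma osg_None (a : R) : (osg a == None) = (a == 0).
Proof. by rewrite /osg; case: (a == 0). Qed.

Lemma osg_pos (a : R) : (osg a == Some true) = (0 < a).
Proof. by rewrite /osg; case: ltgtP. Qed.

Lemma osg_neg (a : R) : (osg a == Some false) = (a < 0).
Proof. by rewrite /osg; case: (ltgtP a 0). Qed.

Lemma osg_inj (a b : R) : (a == 0) = (b == 0) -> (0 < a) = (0 < b) -> osg a = osg b.
Proof. by rewrite /osg => -> ->. Qed.

Lemma osgN (a : R) : osg (- a) = omap negb (osg a).
Proof. by rewrite /osg oppr_eq0 oppr_gt0; case: ltgtP. Qed.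

Lemma osgM (a b : R) : 0 < a -> osg (a * b) = osg b.
Proof.
move=> a0; apply: osg_inj; last by rewrite pmulr_rgt0.
by rewrite mulf_eq0 gt_eqF.
Qed.

Lemma osgD (a b : R) : `|b| < `|a| -> osg (a + b) = osg a.
Proof. by move=> h; apply: osg_inj; apply/idP/idP; move: h; case: (ger0P a) => ?;
  case: (ger0P b) => ? h; lra. Qed.

Lemma osg_conic (a b s t : R) : osg a = osg b -> 0 < s -> 0 < t ->
  osg (s * a + t * b) = osg a.
Proof.
move=> ab s0 t0; case: (ltgtP a 0) => [a0|a0|a0].
- have ha : osg a = Some false by apply/eqP; rewrite osg_neg.
  by move: ab; rewrite ha => /esym/eqP; rewrite osg_neg => b0; apply/eqP; rewrite osg_neg; nra.
- have ha : osg a = Some true by apply/eqP; rewrite osg_pos.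
  by move: ab; rewrite ha => /esym/eqP; rewrite osg_pos => b0; apply/eqP; rewrite osg_pos; nra.
- have ha : osg a = None by apply/eqP; rewrite osg_None a0.
  move: ab; rewrite ha => /esym/eqP; rewrite osg_None => /eqP ->.
  by rewrite a0 !mulr0 addr0 /osg eqxx.
Qed.

Lemma sum_osign (T : nmodType) (phi : option bool -> T) :
  \sum_u phi u = phi None + (phi (Some true) + phi (Some false)).
Proof.
rewrite (bigD1 None) //= (bigD1 (Some true)) //= (bigD1 (Some false)) //=.
by rewrite big1 ?addr0 // => -[[]|].
Qed.

Lemma natr_forall (I : finType) (P : pred I) : ([forall i, P i])%:R = \prod_i (P i)%:R :> R.
Proof.
rewrite -(big_andE predT) /= (big_morph (fun b : bool => b%:R : R) (id1 := 1) (op1 := *%R)) //.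
by move=> [] []; rewrite ?mulr1 ?mulr0.
Qed.

End Signs.

(** * Dependencies of configurations in general position *)

Section GeneralPosition.
Variable R : realType.

(** The minimum of the finitely many thresholds serves every [i]; seeding it with 1 covers an empty
    index type. *)
Lemma uniformly_small (I : finType) (P : I -> R -> Prop) :
  (forall i, exists2 d, 0 < d & forall e, 0 < e <= d -> P i e) ->
  exists2 d, 0 < d & forall e, 0 < e <= d -> forall i, P i e.
Proof.
move=> h; have [d hd] : {d : I -> R & forall i, 0 < d i /\ forall e, 0 < e <= d i -> P i e}.
  by apply: (@choice _ _ (fun i d => 0 < d /\ forall e, 0 < e <= d -> P i e)) => i;
    have [d ? ?] := h i; exists d.
exists (\big[Num.min/1]_i d i).
  by apply/bigmin_gtP; split=> // i _; have [] := hd i.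
move=> e /andP[e0 ed] i; have [_] := hd i; apply.
by rewrite e0 (le_trans ed) // bigmin_le_cond.
Qed.

Lemma perturb_signs n (lam mu : 'cV[R]_n) : exists2 e, 0 < e & forall i, lam i 0 != 0 ->
  osg (lam i 0 + e * mu i 0) = osg (lam i 0) /\ osg (lam i 0 - e * mu i 0) = osg (lam i 0).
Proof.
have [|d d0 hd] := @uniformly_small 'I_n (fun i e => lam i 0 != 0 ->
  osg (lam i 0 + e * mu i 0) = osg (lam i 0) /\ osg (lam i 0 - e * mu i 0) = osg (lam i 0));
    last first.
  by exists d => // i; apply: hd; rewrite d0 lexx.
move=> i; have [l0|l0] := eqVneq (lam i 0) 0; first by exists 1.
have lp : 0 < `|lam i 0| by rewrite normr_gt0.
have mp : 0 < `|mu i 0| + 1 by rewrite ltr_pwDr.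
(* Adding 1 keeps the denominator positive when [mu i 0 = 0] and makes the resulting bound
   strict. *)
exists (`|lam i 0| / (`|mu i 0| + 1)); first by rewrite divr_gt0.
move=> e /andP[e0]; rewrite ler_pdivlMr // => he _.
have small : `|e * mu i 0| < `|lam i 0|.
  by rewrite normrM (gtr0_norm e0) (lt_le_trans _ he) // mulrDr mulr1 ltrDl.
by split; apply: osgD; rewrite ?normrN.
Qed.

Variables r n : nat.
Implicit Types (V : 'M[R]_(r, n)) (lam mu : 'cV[R]_n).

Definition supp lam : {set 'I_n} := [set i | lam i 0 != 0].

(** With [S] listed before its complement, the first [r] entries contain all of [S]. *)
Lemma injection_covering (S : {set 'I_n}) : (#|S| <= r)%N -> (r <= n)%N ->
  exists2 f : 'I_r -> 'I_n, injective f & forall i, i \in S -> exists k, f k = i.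
Proof.
move=> Sr rn; pose s := enum S ++ enum (~: S).
have us : uniq s.
  rewrite cat_uniq !enum_uniq andbT /=; apply/hasPn => i.
  by rewrite /= !mem_enum inE.
have szs : size s = n by rewrite size_cat -!cardE cardsC card_ord.
have lt (k : 'I_r) : (k < size s)%N by rewrite szs (leq_trans (ltn_ord k)).
exists (fun k : 'I_r => nth (widen_ord rn k) s k).
  move=> k k'; rewrite (set_nth_default (widen_ord rn k') (widen_ord rn k) (lt k)) => /eqP.
  by rewrite nth_uniq // => /eqP/val_inj.
move=> i iS; have ir : (index i s < r)%N.
  apply: leq_trans Sr; rewrite index_cat mem_enum iS cardE index_mem mem_enum //.
exists (Ordinal ir); rewrite nth_index //=.
by rewrite mem_cat mem_enum iS.
Qed.

Lemma mulmx_colsub V lam (f : 'I_r -> 'I_n) : injective f ->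
  (forall i, lam i 0 != 0 -> exists k, f k = i) ->
  V *m lam = colsub f V *m rowsub f lam.
Proof.
move=> fi hf; apply/colP => a; rewrite !mxE.
rewrite (bigID (mem (f @: setT))) /= [X in _ + X]big1 ?addr0.
  rewrite big_imset /=; last by move=> ? ? _ _; apply: fi.
  by apply: eq_big => [k|k _]; rewrite ?inE ?mxE.
move=> i /imsetP ni; have [->|/hf [k fk]] := eqVneq (lam i 0) 0; first by rewrite mulr0.
by case: ni; exists k.
Qed.

Lemma colsub_regular V lam (f : 'I_r -> 'I_n) : injective f -> \det (colsub f V) != 0 ->
  (forall i, lam i 0 != 0 -> exists k, f k = i) -> V *m lam = 0 -> lam = 0.
Proof.
move=> fi; rewrite -unitfE => u hs Vl; have um : colsub f V \in unitmx by rewrite unitmxE.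
have z : rowsub f lam = 0.
  by rewrite -[LHS](mulKmx um) -(mulmx_colsub _ fi hs) Vl mulmx0.
apply/colP => i; rewrite [RHS]mxE; apply/eqP/negPn/negP => /[dup] li /hs [k fk].
by move: li; rewrite -fk; have /colP /(_ k) := z; rewrite !mxE => ->; rewrite eqxx.
Qed.

Lemma colsub_extend (f : 'I_r -> 'I_n) (w : 'cV[R]_r) : injective f ->
  exists lam, (forall i, lam i 0 != 0 -> exists k, f k = i) /\ rowsub f lam = w.
Proof.
move=> fi; exists (\col_i \sum_k (f k == i)%:R * w k 0); split.
  move=> i li; apply/not_existsP => nf; move/negP: li; apply; rewrite mxE big1 // => k _.
  by case: eqP (nf k) => // _ _; rewrite mul0r.
apply/colP => k; rewrite !mxE (bigD1 k) //= eqxx mul1r big1 ?addr0 // => k' /negbTE nk.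
by rewrite (inj_eq fi) nk mul0r.
Qed.

Lemma colsub_singular V (f : 'I_r -> 'I_n) : injective f -> \det (colsub f V) = 0 ->
  exists lam, [/\ lam != 0, V *m lam = 0 & forall i, lam i 0 != 0 -> exists k, f k = i].
Proof.
move=> fi /eqP; rewrite -det_tr => /det0P [w w0 wV].
have [lam [hs lw]] := colsub_extend w^T fi; exists lam; split=> //.
  apply: contra w0 => /eqP l0; rewrite -[w]trmxK -lw l0; apply/eqP/matrixP => i k.
  by rewrite !mxE.
by rewrite (mulmx_colsub _ fi hs) lw; apply: trmx_inj; rewrite trmx_mul trmxK wV trmx0.
Qed.

(** A support of at most [r] indices fits into [r] columns, which form a regular matrix. General
    position is mostly used in this dual form; [general_position_dep] is the converse. *)
Lemma dependency_large V lam : (r <= n)%N -> general_position V ->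
  V *m lam = 0 -> (#|supp lam| <= r)%N -> lam = 0.
Proof.
move=> rn gp Vl /injection_covering /(_ rn) [f fi hf].
by apply: (colsub_regular fi (gp f fi) _ Vl) => i li; apply: hf; rewrite inE.
Qed.

Lemma card_supp_image lam (f : 'I_r -> 'I_n) :
  (forall i, lam i 0 != 0 -> exists k, f k = i) -> (#|supp lam| <= r)%N.
Proof.
move=> hs; apply: (@leq_trans #|f @: setT|); last first.
  by rewrite (leq_trans (leq_imset_card _ _)) // cardsT card_ord.
by apply/subset_leq_card/subsetP => i; rewrite inE => /hs [k <-]; apply: imset_f.
Qed.

Lemma general_position_dep V :
  (forall lam, V *m lam = 0 -> (#|supp lam| <= r)%N -> lam = 0) -> general_position V.
Proof.
move=> h f fi; apply/eqP => /(colsub_singular fi) [lam [/eqP l0 Vl hs]].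
exact/l0/h/(card_supp_image hs).
Qed.

(** Some [r] columns outside [A] form an invertible matrix, so once the values on [A] are fixed the
    equations are solved in those columns. Dually, the coordinates in [A] are independent
    functionals on the space of dependencies. *)
Lemma dependency_free V (A : {set 'I_n}) (c : 'I_n -> R) :
  (r <= n)%N -> general_position V -> (#|A| <= n - r)%N ->
  exists2 mu : 'cV[R]_n, V *m mu = 0 & forall i, i \in A -> mu i 0 = c i.
Proof.
move=> rn gp An.
have Bn : (r <= #|~: A|)%N.
  by have := cardsC A; rewrite card_ord; lia.
pose f k : 'I_n := enum_val (widen_ord Bn k).
have fi : injective f by move=> k k' /enum_val_inj /(congr1 val) /= /val_inj.
have fA k : f k \in A = false by apply/negbTE; have := enum_valP (widen_ord Bn k); rewrite inE.
have := gp f fi; rewrite -unitfE -unitmxE => um.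
pose cA : 'cV[R]_n := \col_i if i \in A then c i else 0.
pose y := - (invmx (colsub f V) *m (V *m cA)).
have [lam [hs ly]] := colsub_extend y fi.
exists (cA + lam).
  by rewrite mulmxDr (mulmx_colsub _ fi hs) ly mulmxN mulKVmx // subrr.
move=> i iA; rewrite 2!mxE iA; have [->|/hs [k fk]] := eqVneq (lam i 0) 0; first by rewrite addr0.
by move: iA; rewrite -fk fA.
Qed.

End GeneralPosition.

(** * Euler relations for the cones of dependencies *)

Section Euler.
Variable R : realType.
Variables r n : nat.
Implicit Types (V : 'M[R]_(r, n)) (lam mu : 'cV[R]_n).

Notation sgvec := {ffun 'I_n -> option bool}.

Definition sv lam : sgvec := [ffun i => osg (lam i 0)].
Definition zeros (F : sgvec) : {set 'I_n} := [set i | F i == None].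

(** The zero vector is kept here because Euler's relation for open cones counts the origin; [FS]
    drops it. *)
Definition SV V : {set sgvec} := [set F | `[< exists2 lam, V *m lam = 0 & F = sv lam >]].
Definition zsv : sgvec := [ffun=> None].
Definition FS V : {set sgvec} := SV V :\ zsv.

Definition agree (A : {set 'I_n}) (F G : sgvec) : bool := [forall i in A, F i == G i].

(** In general position the exponent is the dimension of the cone of dependencies with sign vector
    [F]; truncated subtraction gives the origin dimension 0. *)
Definition chi (F : sgvec) : R := (-1) ^+ (n - r - #|zeros F|).

Lemma SVP V F : reflect (exists2 lam, V *m lam = 0 & F = sv lam) (F \in SV V).
Proof. by rewrite inE; apply: asboolP. Qed.

Lemma sv_eq0 lam : (sv lam == zsv) = (lam == 0).
Proof.
apply/eqP/eqP => [h|->]; last by apply/ffunP => i; rewrite !ffunE mxE /osg eqxx.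
apply/colP => i; rewrite mxE; apply/eqP; rewrite -osg_None.
by have /ffunP /(_ i) := h; rewrite !ffunE => ->.
Qed.

Lemma FSP V F : reflect (exists lam, [/\ lam != 0, V *m lam = 0 & F = sv lam]) (F \in FS V).
Proof.
rewrite in_setD1; apply: (iffP andP) => [[F0 /SVP [lam Vl Fl]]|[lam [l0 Vl Fl]]].
  by exists lam; rewrite -sv_eq0 -Fl.
by split; [rewrite Fl sv_eq0|apply/SVP; exists lam].
Qed.

Lemma agreeP (A : {set 'I_n}) (F G : sgvec) : reflect {in A, F =1 G} (agree A F G).
Proof.
apply: (iffP forall_inP) => h i /h; first by move/eqP.
by move=> ->.
Qed.

Hypothesis rn : (r <= n)%N.

Lemma card_supp_zeros lam : (#|supp lam| + #|zeros (sv lam)| = n)%N.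
Proof.
have -> : zeros (sv lam) = ~: supp lam.
  by apply/setP => i; rewrite !inE ffunE osg_None negbK.
by rewrite cardsC card_ord.
Qed.

Lemma SV_zeros V F : general_position V -> F \in SV V -> (n - r <= #|zeros F|)%N -> F = zsv.
Proof.
move=> gp /SVP [lam Vl ->] hz; apply/eqP; rewrite sv_eq0.
apply/eqP/(dependency_large rn gp Vl).
have := card_supp_zeros lam; lia.
Qed.

Lemma FS_zeros V F : general_position V -> F \in FS V -> (#|zeros F| < n - r)%N.
Proof.
move=> gp; rewrite in_setD1 => /andP[F0 FV].
by rewrite ltnNge; apply: contra F0 => h; rewrite (SV_zeros gp FV h).
Qed.

Lemma dependency_signs V (A : {set 'I_n}) (T : sgvec) :
  general_position V -> (#|A| <= n - r)%N ->
  exists2 mu : 'cV[R]_n, V *m mu = 0 & forall i, i \in A -> osg (mu i 0) = T i.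
Proof.
move=> gp An.
pose c i : R := match T i with None => 0 | Some true => 1 | Some false => -1 end.
have [mu Vmu hmu] := dependency_free c rn gp An.
exists mu => // i iA; rewrite hmu // /c /osg; case: (T i) => [[]|];
  by rewrite ?eqxx ?oppr_eq0 ?oner_eq0 ?ltr01 // ltr0N1.
Qed.

Lemma chi_FS V F : general_position V -> F \in FS V -> chi F = (-1) ^+ (n - r) * (-1) ^+
  #|zeros F|.
Proof.
move=> gp FV; rewrite /chi -[in RHS](subnK (ltnW (FS_zeros gp FV))) exprD -mulrA -exprD.
by rewrite addnn -mul2n exprM sqrrN expr1n expr1n mulr1.
Qed.

Lemma chi_zsv : chi zsv = 1.
Proof.
rewrite /chi; have -> : zeros zsv = setT by apply/setP => i; rewrite !inE ffunE eqxx.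
by rewrite cardsT card_ord subnAC subnn.
Qed.

(* Adding the coordinate [i] to [A] either changes nothing or cuts a relatively
   open cone of dimension [d] into two of dimension [d] and one of dimension [d-1]. *)
Lemma euler_open V (A : {set 'I_n}) lam : general_position V -> V *m lam = 0 ->
  \sum_(F in SV V | agree A F (sv lam)) chi F =
  (-1) ^+ (n - r - #|A :&: zeros (sv lam)|).
Proof.
move=> gp; have [k] := ubnP #|~: A|; elim: k A lam => // k IH A lam kA Vl.
(* With [n - r] vanishing coordinates only the zero dependency is left, and the sum has the single
   term [chi zsv = 1]. *)
have [big|small] := leqP (n - r) #|A :&: zeros (sv lam)|.
  rewrite (eq_bigl (pred1 zsv)) ?big_pred1_eq ?chi_zsv.
    by have /eqP -> : (n - r - #|A :&: zeros (sv lam)| == 0)%N by rewrite subn_eq0.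
  have z F : F \in SV V -> agree A F (sv lam) -> F = zsv.
    move=> FV /agreeP ag; apply: (SV_zeros gp FV); apply: leq_trans big _.
    by apply/subset_leq_card/subsetP => i; rewrite !inE => /andP[iA /eqP <-]; rewrite ag.
  have l0 : sv lam = zsv by apply: z; [apply/SVP; exists lam|apply/agreeP].
  move=> F; apply/andP/eqP => [[FV /z]|->]; first exact.
  by rewrite l0; split; [apply/SVP; exists lam|apply/agreeP].
have [A1|[i iA]] : ~: A = set0 \/ exists i, i \in ~: A.
  by have [->|/set0Pn] := eqVneq (~: A) set0; [left|right].
  rewrite (eq_bigl (pred1 (sv lam))) ?big_pred1_eq /chi.
    by rewrite -[A]setCK A1 setC0 setTI.
  move=> F; apply/andP/eqP => [[_ /agreeP ag]|->].
    by apply/ffunP => i; apply: ag; rewrite -[A]setCK A1 setC0 inE.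
  by split; [apply/SVP; exists lam|apply/agreeP].
have iA' : i \notin A by rewrite inE in iA.
(* One slice of the cone by the sign of coordinate [i], represented by [mu]; a vanishing coordinate
   lowers the dimension by one. *)
have IHi mu : V *m mu = 0 -> agree A (sv mu) (sv lam) ->
  \sum_(F in SV V | agree A F (sv lam) && (F i == osg (mu i 0))) chi F =
  (-1) ^+ (n - r - (#|A :&: zeros (sv lam)| + (mu i 0 == 0)%R)).
  move=> Vmu /agreeP amu; have := IH (i |: A) mu.
  rewrite (_ : #|(i |: A) :&: zeros (sv mu)| = #|A :&: zeros (sv lam)| + (mu i 0 == 0)%R)%N.
    move=> <- //; last first.
      by have := cardsD1 i (~: A); rewrite iA setCU setIC -setDE => h; lia.
    apply: eq_bigl => F; congr (_ && _).
    apply/andP/agreeP => [[/agreeP ag /eqP Fi] j|ag].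
      by rewrite !inE => /orP[/eqP ->|jA]; [rewrite ffunE|rewrite amu // ag].
    split; last by rewrite ag ?setU11 // ffunE.
    by apply/agreeP => j jA; rewrite ag ?setU1r // amu.
  rewrite setIUl addnC; have -> : A :&: zeros (sv mu) = A :&: zeros (sv lam).
    apply/setP => j; rewrite !in_setI; case jA: (j \in A) => //=.
    by rewrite !inE amu.
  have [mi|mi] := eqVneq (mu i 0) 0.
    rewrite (_ : [set i] :&: _ = [set i]); first by rewrite cardsU1 in_setI (negbTE iA').
    by apply/setIidPl/subsetP => j; rewrite !inE => /eqP ->; rewrite ffunE osg_None mi.
  rewrite (_ : [set i] :&: _ = set0) ?set0U //.
  apply/setP => j; rewrite !inE; case: eqP => //= ->.
  by rewrite ffunE osg_None (negbTE mi).
have split_i : \sum_(F in SV V | agree A F (sv lam)) chi F =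
  \sum_u \sum_(F in SV V | agree A F (sv lam) && (F i == u)) chi F.
  rewrite (partition_big (fun F : sgvec => F i) predT) //=.
  by apply: eq_bigr => u _; apply: eq_bigl => F; rewrite andbA.
(* The question is whether the hyperplane of vanishing coordinate [i] meets the cone. If it does,
   small moves from [nu] along [mu] and [- mu] represent the two open halves. *)
have [[nu [Vnu anu nui]]|nozero] := pselect
    (exists nu, [/\ V *m nu = 0, agree A (sv nu) (sv lam) & nu i 0 = 0]).
  have An : (#|i |: (A :&: zeros (sv lam))| <= n - r)%N.
    by rewrite cardsU1 in_setI (negbTE iA').
  have [mu Vmu hmu] := dependency_free (fun j => (j == i)%:R) rn gp An.
  have mui : mu i 0 = 1 by rewrite hmu ?setU11 // eqxx.
  have [e e0 he] := perturb_signs nu mu.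
  have perturbed s : s = e \/ s = - e ->
    V *m (nu + s *: mu) = 0 /\ agree A (sv (nu + s *: mu)) (sv lam).
    move=> hs; split; first by rewrite mulmxDr -scalemxAr Vmu Vnu scaler0 addr0.
    apply/agreeP => j jA; rewrite -(agreeP _ _ _ anu) // !ffunE !mxE.
    have [nj|/he [? ?]] := eqVneq (nu j 0) 0; last by case: hs => ->; rewrite ?mulNr.
    rewrite nj hmu; last first.
      rewrite !inE jA /= -(agreeP _ _ _ anu) // ffunE osg_None nj eqxx orbT //.
    by rewrite (_ : j == i = false) ?mulr0 ?addr0 //; apply: contraNF iA' => /eqP <-.
  have vi s : (nu + s *: mu) i 0 = s by rewrite !mxE nui mui add0r mulr1.
  have [V1 a1] := perturbed e (or_introl erefl).
  have [V2 a2] := perturbed (- e) (or_intror erefl).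
  rewrite split_i sum_osign; have := IHi nu Vnu anu.
  have := IHi _ V1 a1; have := IHi _ V2 a2; rewrite !vi nui eqxx.
  have /eqP -> : osg e == Some true by rewrite osg_pos.
  have /eqP -> : osg (- e) == Some false by rewrite osg_neg oppr_lt0.
  have /eqP -> : osg (0 : R) == None by rewrite osg_None.
  rewrite oppr_eq0 gt_eqF // addn0 addn1 => -> -> ->.
  by rewrite -(subnSK small) exprS mulN1r; move: (_ ^+ _) => x; ring.
have li : lam i 0 != 0.
  by apply/eqP => l0; apply: nozero; exists lam; split => //; apply/agreeP.
have := IHi lam Vl; rewrite (negbTE li) addn0 => <-; last by apply/agreeP.
apply: eq_bigl => F; case FV: (F \in SV V) => //=; case ag: (agree _ _ _) => //=.
apply/esym; case/SVP: FV ag => mu Vmu -> amu; rewrite ffunE; apply/eqP.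
(* A member with another sign at [i] would give a member vanishing there: [mu] itself, or a positive
   combination with [lam], since the cone is convex. *)
have [//|ne] := eqVneq (osg (mu i 0)) (osg (lam i 0)); case: nozero.
have [m0|mi] := eqVneq (mu i 0) 0; first by exists mu.
exists (`|mu i 0| *: lam + `|lam i 0| *: mu); split.
- by rewrite mulmxDr -!scalemxAr Vmu Vl !scaler0 addr0.
- apply/agreeP => j jA; rewrite !ffunE !mxE osg_conic ?normr_gt0 //.
  by have /agreeP /(_ j jA) := amu; rewrite !ffunE.
rewrite !mxE; case: (ltgtP (mu i 0) 0) (mi) => // m _; case: (ltgtP (lam i 0) 0) (li) => // l _.
- by case/eqP: ne; have [/eqP-> /eqP->] : osg (mu i 0) == Some false /\ osg (lam i 0) == Some
  false by rewrite !osg_neg.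
- by rewrite ltr0_norm // gtr0_norm //; ring.
- by rewrite gtr0_norm // ltr0_norm //; ring.
- by case/eqP: ne; have [/eqP-> /eqP->] : osg (mu i 0) == Some true /\ osg (lam i 0) == Some
  true by rewrite !osg_pos.
Qed.

(** For realized vectors this is the face order: the cone of [F] lies in the closure of the cone of
    [G]. *)
Definition conformal (F G : sgvec) : bool := [forall i, (F i == None) || (F i == G i)].

(** Fewer than [n - r] coordinates of [F] vanish, so some dependency has the signs of [G] there;
    adding a small multiple of it to a dependency realizing [F] realizes [G]. This is the simplicity
    of the arrangement. *)
Lemma FS_conformal V F G : general_position V -> F \in FS V -> conformal F G -> G \in FS V.
Proof.
move=> gp FV /forallP FG.
have [mu Vmu hmu] := dependency_signs G gp (ltnW (FS_zeros gp FV)).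
case/FSP: FV => lam [l0 Vl Fl].
have [e e0 he] := perturb_signs lam mu.
have GE : G = sv (lam + e *: mu).
  apply/ffunP => i; rewrite ffunE !mxE; have := FG i; rewrite {1 2}Fl ffunE osg_None.
  have [li _|/he [-> _] /=] := eqVneq (lam i 0) 0; last by move/eqP.
  by rewrite li add0r osgM // hmu // inE Fl ffunE osg_None li.
apply/FSP; exists (lam + e *: mu); split => //.
  rewrite -sv_eq0 -GE; apply: contra l0 => /eqP G0; apply/eqP/colP => i; rewrite mxE; apply/eqP.
  by have := FG i; rewrite G0 Fl !ffunE orbb osg_None.
by rewrite mulmxDr -scalemxAr Vmu Vl scaler0 addr0.
Qed.

(* Inclusion-exclusion over the conditions [F i != - G i]: since [- G] is realized as
   well, [euler_open] gives every term of the sum the same absolute value. *)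
Lemma euler_closed V G : general_position V -> G \in FS V ->
  \sum_(F in FS V | conformal F G) chi F = -1.
Proof.
move=> gp GV; have /FSP [lam [l0 Vl Gl]] := GV.
have zN : zeros (sv (- lam)) = zeros G.
  by apply/setP => i; rewrite !inE Gl !ffunE mxE !osg_None oppr_eq0.
(* At a zero of [G] the condition on [F] is [F i = - G i]; elsewhere its indicator is 1 minus that
   of [F i = - G i]. The number [e i b] is the coefficient for choosing ([b] true) or omitting that
   indicator. *)
pose e i (b : bool) : R := if G i == None then b%:R else (-1) ^+ b.
have indicator (F : sgvec) : (conformal F G)%:R =
    \sum_(J : {set 'I_n}) \prod_i e i (i \in J) * (agree J F (sv (- lam)))%:R :> R.
  pose f b i : R := e i b * (b ==> (F i == sv (- lam) i))%:R.
  transitivity (\prod_i (f true i + f false i)).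
    rewrite /conformal natr_forall; apply: eq_bigr => i _; rewrite /f /e ffunE mxE osgN Gl ffunE.
    case: (osg (lam i 0)) => [[]|]; case: (F i) => [[]|] //=;
      by rewrite ?expr1 ?expr0 ?mulr0 ?mulr1 ?add0r ?addr0 ?addNr.
  rewrite bigA_distr; apply: eq_bigr => J _.
  rewrite (eq_bigr (fun i => e i (i \in J) * ((i \in J) ==> (F i == sv (- lam) i))%:R));
    last first.
    by move=> i _; rewrite /f; case: (i \in J).
  rewrite big_split /=; congr (_ * _).
  by rewrite /agree natr_forall.
have total : \sum_(F in SV V | conformal F G) chi F = 0.
  rewrite big_mkcondr /= (eq_bigr (fun F => \sum_(J : {set 'I_n})
      \prod_i e i (i \in J) * ((agree J F (sv (- lam)))%:R * chi F))); last first.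
    move=> F _; transitivity ((conformal F G)%:R * chi F).
      by case: ifP; rewrite ?mul1r ?mul0r.
    by rewrite indicator mulr_suml; apply: eq_bigr => J _; rewrite mulrA.
  rewrite exchange_big /= (eq_bigr (fun J : {set 'I_n} =>
      \prod_i e i (i \in J) * (-1) ^+ (n - r - #|zeros G|))); last first.
    move=> J _; rewrite -mulr_sumr.
    have [zJ|/subsetPn [i iz iJ]] := boolP (zeros G \subset J); last first.
      by rewrite (bigD1 i) //= [e i _]/e -[G i == None](in_set (fun i => G i == None)) iz
        (negbTE iJ) !mul0r.
    congr (_ * _); have -> : zeros G = J :&: zeros (sv (- lam)) by rewrite zN;
      apply/esym/setIidPr.
    rewrite -(euler_open _ gp); last by rewrite mulmxN Vl oppr0.
    rewrite [RHS]big_mkcondr; apply: eq_bigr => F _.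
    by case: ifP; rewrite ?mul1r ?mul0r.
  (* The sum over [J] factors over the coordinates, and one with [G i] nonzero contributes
     [-1 + 1 = 0]. *)
  rewrite -mulr_suml; have [i Gi] : exists i, G i != None.
    apply/not_existsP => h; case/eqP: l0; apply/colP => i; rewrite mxE; apply/eqP.
    by rewrite -osg_None; apply/negPn/negP; have := h i; rewrite Gl ffunE.
  have -> : \sum_(J : {set 'I_n}) \prod_i e i (i \in J) = \prod_i (e i true + e i false).
    rewrite bigA_distr; apply: eq_bigr => J _; apply: eq_bigr => k _.
    by case: (k \in J).
  by rewrite (bigD1 i) //= /e (negbTE Gi) expr1 expr0 addNr !mul0r.
have zG : conformal zsv G by apply/forallP => i; rewrite ffunE.
have zV : zsv \in SV V.
  by apply/SVP; exists 0; [rewrite mulmx0|apply/esym/eqP; rewrite sv_eq0].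
move: total; rewrite (bigD1 zsv) /=; last by rewrite zV.
rewrite chi_zsv => /eqP; rewrite addrC addr_eq0 => /eqP <-.
by apply: eq_bigl => F; rewrite !inE; case: (F == zsv); rewrite ?andbF ?andbT.
Qed.

(* Starting from a dependency with at least [r + 2] nonzero coordinates, move along
   another one, vanishing at a coordinate [i1] of the support, until a coordinate dies. *)
Lemma FS_circuit V F : general_position V -> F \in FS V ->
  exists lam : 'cV[R]_n, [/\ V *m lam = 0, conformal (sv lam) F & #|supp lam| = r.+1].
Proof.
move=> gp /FSP [lam [l0 Vl Fl]].
rewrite {F}Fl; have [N] := ubnP #|supp lam|; elim: N lam l0 Vl => // N IH lam l0 Vl ltN.
have [small|] := leqP #|supp lam| r.
  by case/eqP: l0; apply: (dependency_large rn gp Vl small).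
rewrite leq_eqVlt => /orP[/eqP eqr|gtr].
  by exists lam; split=> //; apply/forallP => i; rewrite eqxx orbT.
have /card_gt1P [i1 [i2 [s1 s2 ne]]] : (1 < #|supp lam|)%N by apply: leq_trans gtr.
(* There are at most [n - r] prescriptions for [mu]: it vanishes at [i1] and at every zero of [lam],
   and equals [lam] at [i2]. *)
have An : (#|i1 |: (i2 |: ~: supp lam)| <= n - r)%N.
  have := cardsC (supp lam); rewrite card_ord !cardsU1.
  by case: (_ \notin _); case: (_ \notin _); lia.
have [mu Vmu hmu] := dependency_free (fun i => (i == i2)%:R * lam i2 0) rn gp An.
have mu1 : mu i1 0 = 0 by rewrite hmu ?setU11 // (negbTE ne) mul0r.
have mu2 : mu i2 0 = lam i2 0 by rewrite hmu ?inE ?eqxx ?orbT // mul1r.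
have muC i : lam i 0 = 0 -> mu i 0 = 0.
  move=> li; rewrite hmu ?inE ?li ?eqxx ?orbT //.
  by have [<-|_] := eqVneq i i2; rewrite ?li ?mulr0 ?mul0r.
(* These coordinates are driven towards zero when multiples of [mu] are subtracted. The least ratio
   [tau] is the moment when the first of them dies, and [i2] shows that there is one. *)
pose P i := 0 < lam i 0 * mu i 0.
have P2 : P i2 by rewrite /P mu2 -expr2 exprn_even_gt0 //=; move: s2; rewrite inE.
case: (Order.TotalTheory.arg_minP (fun i => lam i 0 / mu i 0) P2) => i3 P3 min3.
pose tau := lam i3 0 / mu i3 0.
have m3 : mu i3 0 != 0 by move: P3; rewrite /P; apply: contraTneq => ->; rewrite mulr0 ltxx.
have tau0 : 0 < tau.
  have -> : tau = lam i3 0 * mu i3 0 / mu i3 0 ^+ 2 by rewrite /tau; field.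
  by rewrite divr_gt0 // exprn_even_gt0.
pose nu := lam - tau *: mu.
have nuE i : nu i 0 = lam i 0 - tau * mu i 0 by rewrite !mxE.
have cnu : conformal (sv nu) (sv lam).
  apply/forallP => i; rewrite !ffunE nuE.
  have [li|li] := eqVneq (lam i 0) 0; first by rewrite li (muC _ li) mulr0 subr0 /osg eqxx.
  have [Pi|] := boolP (P i).
    have := min3 i Pi; rewrite -/tau.
    have mi : mu i 0 != 0 by move: Pi; rewrite /P; apply: contraTneq => ->; rewrite mulr0 ltxx.
    move: Pi; rewrite /P; have [mp|mn|m0] := ltgtP (mu i 0) 0; last by rewrite m0 eqxx in mi.
      rewrite nmulr_lgt0 // => ln; rewrite ler_ndivlMr // => h.
      have /eqP -> : osg (lam i 0) == Some false by rewrite osg_neg.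
      by rewrite osg_None osg_neg; case: ltgtP => //; rewrite ?subr_gt0; lra.
    rewrite pmulr_lgt0 // => ln; rewrite ler_pdivlMr // => h.
    have /eqP -> : osg (lam i 0) == Some true by rewrite osg_pos.
    by rewrite osg_None osg_pos; case: ltgtP => //; rewrite ?subr_lt0; lra.
  rewrite /P -leNgt => h; apply/orP; right; apply/eqP.
  have [lp|ln|] := ltgtP (lam i 0) 0; last by move=> l; rewrite l eqxx in li.
    have /eqP -> : osg (lam i 0) == Some false by rewrite osg_neg.
    by apply/eqP; rewrite osg_neg; nra.
  have /eqP -> : osg (lam i 0) == Some true by rewrite osg_pos.
  by apply/eqP; rewrite osg_pos; nra.
have nu1 : nu i1 0 != 0 by rewrite nuE mu1 mulr0 subr0; move: s1; rewrite inE.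
have nu3 : nu i3 0 = 0 by rewrite nuE /tau; field.
have l3 : i3 \in supp lam by rewrite inE; apply: contraTneq P3; rewrite /P => ->;
  rewrite mul0r ltxx.
have sub : supp nu \proper supp lam.
  apply/properP; split; last by exists i3 => //; rewrite inE nu3 eqxx.
  apply/subsetP => i; rewrite !inE nuE; apply: contraNneq => li.
  by rewrite li (muC _ li) mulr0 subr0.
have [||mu' [Vmu' cmu' smu']] := IH nu _ _ (leq_trans (proper_card sub) ltN).
- by apply: contra nu1 => /eqP ->; rewrite mxE.
- by rewrite mulmxBr -scalemxAr Vmu Vl scaler0 subr0.
exists mu'; split=> //; apply/forallP => i; have := forallP cmu' i; have := forallP cnu i.
by case/orP=> /eqP -> /orP[->//|/eqP ->]; rewrite eqxx ?orbT.
Qed.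

End Euler.

(** * The weighted enumerator of sign vectors *)

Section Enumerator.
Variable R : realType.
Variables r n : nat.
Hypothesis rn : (r <= n)%N.
Implicit Types (V W : 'M[R]_(r, n)) (x y z a d : R).

Notation sgvec := {ffun 'I_n -> option bool}.

Definition wt x y z (u : option bool) : R :=
  match u with None => x | Some true => z | Some false => y end.

Definition enumerator V x y z : R := \sum_(F in FS V) \prod_i wt x y z (F i).

Definition negv (F : sgvec) : sgvec := [ffun i => omap negb (F i)].

Lemma negvK : involutive negv.
Proof. by move=> F; apply/ffunP => i; rewrite !ffunE; case: (F i) => [[]|]. Qed.

Lemma sv_opp (lam : 'cV[R]_n) : sv (- lam) = negv (sv lam).
Proof. by apply/ffunP => i; rewrite !ffunE mxE osgN. Qed.

Lemma FS_negv V F : (negv F \in FS V) = (F \in FS V).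
Proof.
suff h G : G \in FS V -> negv G \in FS V by apply/idP/idP => /h; rewrite ?negvK.
case/FSP => lam [l0 Vl ->]; apply/FSP; exists (- lam).
by rewrite oppr_eq0 mulmxN Vl oppr0 sv_opp.
Qed.

Lemma enumerator_antipode V x y z : enumerator V x z y = enumerator V x y z.
Proof.
rewrite /enumerator (reindex_inj (inv_inj negvK)) /=.
apply: eq_big => [F|F _]; first exact: FS_negv.
by apply: eq_bigr => i _; rewrite ffunE; case: (F i) => [[]|].
Qed.

Lemma signr_zeros (F : sgvec) : (-1) ^+ #|zeros F| = \prod_i wt (-1) 1 1 (F i) :> R.
Proof.
rewrite (bigID (mem (zeros F))) /= [X in _ * X]big1 ?mulr1.
  by rewrite -prodr_const; apply: eq_bigr => i; rewrite inE => /eqP ->.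
by move=> i; rewrite inE; case: (F i) => [[]|].
Qed.

(** The new weight of a zero is minus the sum of the three old weights, so expanding the product
    over the zeros of [F] runs over all [G] above [F]. After exchanging the sums, each [G] in [FS V]
    carries the sum of [euler_closed], and any other [G] has no vector of [FS V] below it. *)
Lemma enumerator_dual V x y z : general_position V ->
  enumerator V (- x - y - z) y z = - (-1) ^+ (n - r) * enumerator V x y z.
Proof.
move=> gp; pose M (u s : option bool) : R := if u == None then -1 else (u == s)%:R.
have step (F : sgvec) : \prod_i wt (- x - y - z) y z (F i) =
    \sum_(G : sgvec) (-1) ^+ #|zeros F| * (conformal F G)%:R * \prod_i wt x y z (G i).
  transitivity (\prod_i \sum_s M (F i) s * wt x y z s).
    apply: eq_bigr => i _; rewrite sum_osign /M.
    by case: (F i) => [[]|] /=; ring.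
  rewrite bigA_distr_bigA; apply: eq_bigr => G _; rewrite big_split /=; congr (_ * _).
  rewrite signr_zeros natr_forall -big_split; apply: eq_bigr => i _.
  by rewrite /M; case: (F i) => [[]|] /=; rewrite ?mul1r ?mulr1.
rewrite /enumerator (eq_bigr _ (fun F _ => step F)) exchange_big /= mulr_sumr.
rewrite [RHS]big_mkcond; apply: eq_bigr => G _; rewrite -mulr_suml.
have -> : \sum_(F in FS V) (-1) ^+ #|zeros F| * (conformal F G)%:R =
   \sum_(F in FS V | conformal F G) (-1) ^+ #|zeros F| :> R.
  by rewrite [RHS]big_mkcondr; apply: eq_bigr => F _; case: ifP; rewrite ?mulr1 ?mulr0.
case: ifPn => GV; last first.
  rewrite big1 ?mul0r // => F /andP[FV FG]; case/negP: GV.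
  exact: (FS_conformal rn gp FV FG).
congr (_ * _); transitivity ((-1) ^+ (n - r) * \sum_(F in FS V | conformal F G) chi R r F);
  last first.
  by rewrite (euler_closed rn gp GV) mulrN1.
rewrite mulr_sumr; apply: eq_bigr => F /andP[FV _].
by rewrite (chi_FS rn gp FV) signrMK.
Qed.

(** Pairing the dependency with [u] gives a vanishing combination with positive weights, impossible
    for a nonzero vector without negative entries. *)
Lemma FS_pointed V F : pointed V -> F \in FS V -> exists i, F i = Some false.
Proof.
move=> [u [_ up]] /FSP [lam [l0 Vl ->]].
have s0 : \sum_i (\sum_(j < r) u j * V j i) * lam i 0 = 0.
  under eq_bigr do rewrite mulr_suml.
  rewrite exchange_big big1 //= => j _; under eq_bigr do rewrite -mulrA.
  by rewrite -mulr_sumr; have /colP /(_ j) := Vl; rewrite !mxE => ->; rewrite mulr0.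
have [i li] : exists i, lam i 0 < 0.
  apply/not_existsP => h; case/eqP: l0; apply/colP => i; rewrite mxE; apply/eqP.
  have ge0 k : 0 <= lam k 0 by rewrite leNgt; apply/negP/h.
  have := psumr_eq0P (fun k _ => mulr_ge0 (ltW (up k)) (ge0 k)) s0.
  by move=> /(_ i isT) /eqP; rewrite mulf_eq0 gt_eqF.
by exists i; apply/eqP; rewrite ffunE osg_neg.
Qed.

Lemma enumerator_pointed V x z : pointed V -> enumerator V x 0 z = 0.
Proof.
move=> pV; rewrite /enumerator big1 // => F /(FS_pointed pV) [i Fi].
by rewrite (bigD1 i) //= Fi mul0r.
Qed.

(* With [x = a - y] and [z = y - d] every weight is affine in [y]; expanding the
   products by the set [Q] of coordinates contributing [y] gives these coefficients. *)
Definition coef_at V (Q : {set 'I_n}) a d : R :=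
  \sum_(F in FS V) \prod_i (if i \in Q then wt (-1) 1 1 (F i) else wt a 0 (- d) (F i)).

Lemma enumerator_expand V a y d :
  enumerator V (a - y) y (y - d) = \sum_(Q : {set 'I_n}) y ^+ #|Q| * coef_at V Q a d.
Proof.
under [RHS]eq_bigr do rewrite mulr_sumr.
rewrite exchange_big /=; apply: eq_bigr => F _.
transitivity (\prod_i (y * wt (-1) 1 1 (F i) + wt a 0 (- d) (F i))).
  by apply: eq_bigr => i _; case: (F i) => [[]|] /=; ring.
rewrite bigA_distr; apply: eq_bigr => Q _.
rewrite (bigID (mem Q)) [in RHS](bigID (mem Q)) /= mulrA; congr (_ * _); last first.
  by apply: eq_bigr => i /negbTE ->.
rewrite -prodr_const -big_split /=; apply: eq_bigr => i iQ.
by rewrite iQ.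
Qed.

Definition restrictv (Q : {set 'I_n}) (F : sgvec) : sgvec :=
  [ffun i => if i \in Q then None else F i].

(* Every sign pattern off a large [Q] is realized, so [euler_open] makes the sum
   over the vectors with that pattern independent of the configuration. *)
Lemma sum_restrictv V (Q : {set 'I_n}) (T : sgvec) : general_position V ->
  (#|~: Q| <= n - r)%N -> restrictv Q T = T ->
  \sum_(F in FS V | restrictv Q F == T) (-1) ^+ #|zeros F| =
  (-1) ^+ (n - r) * ((-1) ^+ (n - r - #|~: Q :&: zeros T|) - (T == zsv n)%:R) :> R.
Proof.
move=> gp Qn QT.
have [lam Vl hl] := dependency_signs rn T gp Qn.
have agreeE F : agree (~: Q) F (sv lam) = (restrictv Q F == T).
  apply/agreeP/eqP => [h|h i iQ].
    apply/ffunP => i; rewrite -QT !ffunE; case: ifPn => // iQ.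
    by rewrite h ?inE // ffunE hl ?inE.
  by rewrite [RHS]ffunE hl // -h ffunE; move: iQ; rewrite inE => /negbTE ->.
have VS : \sum_(F in SV V | restrictv Q F == T) chi R r F = (-1) ^+ (n - r - #|~: Q :&: zeros T|).
  have -> : ~: Q :&: zeros T = ~: Q :&: zeros (sv lam).
    by apply/setP => i; rewrite !inE; case: (boolP (i \in Q)) => //= iQ; rewrite ffunE hl ?inE.
  by rewrite -(euler_open rn (~: Q) gp Vl); apply: eq_bigl => F; rewrite agreeE.
rewrite -{}VS; transitivity ((-1) ^+ (n - r) * \sum_(F in FS V | restrictv Q F == T) chi R r F).
  by rewrite mulr_sumr; apply: eq_bigr => F /andP[FV _]; rewrite (chi_FS rn gp FV) signrMK.
congr (_ * _); apply/eqP; rewrite eq_sym subr_eq addrC; apply/eqP.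
have rz : restrictv Q (zsv n) = zsv n by apply/ffunP => i; rewrite !ffunE if_same.
have zV : zsv n \in SV V.
  by apply/SVP; exists 0; [rewrite mulmx0|apply/esym/eqP; rewrite sv_eq0].
have FSE (F : sgvec) : (F \in FS V) = (F != zsv n) && (F \in SV V) by rewrite in_setD1.
(* The zero vector, counted by [euler_open] but absent from [FS V], has the pattern [T] exactly when
   [T] is zero. *)
have [Tz|Tz] := eqVneq T (zsv n).
  rewrite (bigD1 (zsv n)) /=; last by rewrite zV rz Tz eqxx.
  rewrite chi_zsv Tz; congr (_ + _).
  by apply: eq_bigl => F; rewrite FSE andbC andbA.
rewrite add0r; apply: eq_bigl => F; rewrite FSE.
by have [->|//] := eqVneq F (zsv n); rewrite rz eq_sym (negbTE Tz) andbF.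
Qed.

(** A term depends on [F] only through its pattern off [Q] and the parity of its number of zeros.
    Grouping by pattern leaves the sums of [sum_restrictv], whose values do not involve the
    configuration. *)
Lemma coef_at_indep V W (Q : {set 'I_n}) a d : general_position V -> general_position W ->
  (r <= #|Q|)%N -> coef_at V Q a d = coef_at W Q a d.
Proof.
move=> gV gW Qr; have Qn : (#|~: Q| <= n - r)%N by have := cardsC Q; rewrite card_ord; lia.
pose c (T : sgvec) : R := \prod_(i | i \notin Q) wt a 0 (- d) (T i) * (-1) ^+ #|zeros T :\: Q|.
have term (F : sgvec) : \prod_i (if i \in Q then wt (-1) 1 1 (F i) else wt a 0 (- d) (F i)) =
   c (restrictv Q F) * (-1) ^+ #|zeros F|.
  rewrite (bigID (mem Q)) /= mulrC /c -mulrA; congr (_ * _).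
    by apply: eq_bigr => i iQ; rewrite ffunE (negbTE iQ).
  have -> : zeros (restrictv Q F) :\: Q = zeros F :\: Q.
    by apply/setP => i; rewrite !inE ffunE; case: (i \in Q).
  rewrite -(cardsID Q (zeros F)) addnC exprD signrMK.
  transitivity (\prod_(i in Q) wt (-1) 1 1 (F i)); first by apply: eq_bigr => i ->.
  rewrite (bigID (mem (zeros F))) /= [X in _ * X]big1 ?mulr1; last first.
    by move=> i /andP[_]; rewrite inE; case: (F i) => [[]|].
  rewrite -prodr_const; apply: eq_big => i; first by rewrite !inE andbC.
  by move=> /andP[_]; rewrite inE => /eqP ->.
have expand U : coef_at U Q a d = \sum_(T : sgvec) c T *
    \sum_(F in FS U | restrictv Q F == T) (-1) ^+ #|zeros F|.
  rewrite /coef_at (eq_bigr _ (fun F _ => term F)).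
  rewrite (partition_big (restrictv Q) predT) //=; apply: eq_bigr => T _.
  by rewrite mulr_sumr; apply: eq_bigr => F /andP[_ /eqP ->].
rewrite !expand; apply: eq_bigr => T _; congr (_ * _).
have [QT|QT] := eqVneq (restrictv Q T) T; first by rewrite !sum_restrictv.
have none U : \sum_(F in FS U | restrictv Q F == T) (-1) ^+ #|zeros F| = 0 :> R.
  rewrite big_pred0 // => F; apply/negbTE; rewrite negb_and; apply/orP; right.
  apply: contra QT => /eqP <-; apply/eqP/ffunP => i; rewrite !ffunE.
  by case: (i \in Q).
by rewrite !none.
Qed.

(** A term survives only if [F] has no negative coordinate off [Q], and is then a multiple of a
    monomial of degree [n - #|Q|] in [a] and [d]. By [FS_zeros] the exponent of [a] is at most
    [n - r], so the power of [d] splits: one part completes [a] to degree [n - r], the other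
    completes [y ^+ #|Q|] to degree [r]. *)
Lemma coef_at_small V (Q : {set 'I_n}) : general_position V -> (#|Q| <= r)%N ->
  exists c : sgvec -> R, forall a d, coef_at V Q a d =
    \sum_(F in FS V) c F * (a ^+ #|zeros F :\: Q| * d ^+ (n - r - #|zeros F :\: Q|)) * d ^+ (r
      - #|Q|).
Proof.
move=> gV Qr.
pose neg (F : sgvec) := [exists i, (i \notin Q) && (F i == Some false)].
exists (fun F : sgvec => \prod_(i in Q) wt (-1) 1 1 (F i) * (-1) ^+ (n - #|Q| - #|zeros F :\:
  Q|) * (~~ neg F)%:R) => a d.
apply: eq_bigr => F FV.
have zQ : (#|zeros F :\: Q| <= n - r)%N.
  by apply: leq_trans (ltnW (FS_zeros rn gV FV)); apply/subset_leq_card/subsetDl.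
rewrite (bigID (mem Q)) /= -!mulrA; congr (_ * _); first by apply: eq_bigr => i ->.
rewrite (eq_bigr (fun i => wt a 0 (- d) (F i))); last by move=> i /negbTE ->.
have [/existsP [i /andP[iQ /eqP Fi]]|nF] /= := boolP (neg F).
  by rewrite (bigD1 i) //= Fi !mul0r mulr0.
rewrite mul1r (bigID (mem (zeros F))) /=.
have -> : \prod_(i | (i \notin Q) && (i \in zeros F)) wt a 0 (- d) (F i) = a ^+ #|zeros F :\: Q|.
  rewrite -prodr_const; apply: eq_big => [i|i /andP[_]]; first by rewrite !inE.
  by rewrite inE => /eqP ->.
have -> : \prod_(i | (i \notin Q) && (i \notin zeros F)) wt a 0 (- d) (F i) =
    (- d) ^+ (n - #|Q| - #|zeros F :\: Q|).
  have -> : (n - #|Q| - #|zeros F :\: Q| = #|~: (Q :|: zeros F)|)%N.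
    have := cardsC (Q :|: zeros F); rewrite card_ord.
    have := cardsID Q (Q :|: zeros F); rewrite setDUl setDv set0U.
    by rewrite (_ : (Q :|: zeros F) :&: Q = Q); [lia|rewrite setIC; apply/setIidPl/subsetUl].
  rewrite -prodr_const; apply: eq_big => [i|i /andP[iQ]]; first by rewrite !inE negb_or.
  rewrite inE; case Fi: (F i) => [[]|] //= _.
  by case/negP: nF; apply/existsP; exists i; rewrite iQ Fi.
rewrite [in LHS]exprNn [LHS]mulrCA; congr (_ * (_ * _)); rewrite -exprD; congr (_ ^+ _).
by move: zQ Qr rn; move: #|zeros F :\: Q| #|Q| => p q; lia.
Qed.

End Enumerator.

(** * Bihomogeneous forms *)

Section Forms.
Variable R : realType.

(** A nonzero polynomial has fewer roots than its size. The sample points are positive, as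
    [generic_curve] needs, and differ from 1, as [coef_fun_eq0] needs. *)
Lemma poly_nonroot (p : {poly R}) : p != 0 -> exists i : nat, p.[i.+2%:R] != 0.
Proof.
move=> p0; apply/not_existsP => h.
have := @max_poly_roots _ p [seq i.+2%:R | i <- iota 0 (size p)] p0.
rewrite size_map size_iota ltnn => H; suff: false by []; apply: H.
  by apply/allP => x /mapP [i _ ->]; have /negP := h i; rewrite negbK.
by rewrite map_inj_uniq ?iota_uniq // => i j /eqP; rewrite eqr_nat => /eqP [].
Qed.

Lemma coef_fun_eq0 N (c : 'I_N -> R) :
  (forall x, x != 1 -> \sum_(k < N) c k * x ^+ k = 0) -> forall k, c k = 0.
Proof.
move=> h k; pose p := \poly_(i < N) (if insub i is Some j then c j else 0).
have p0 : p = 0.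
  apply/eqP/negPn/negP => /poly_nonroot [x /negP]; apply; apply/eqP.
  rewrite -[RHS](h x.+2%:R) ?pnatr_eq1 // horner_poly.
  by apply: eq_bigr => i _; rewrite valK.
by have /polyP /(_ k) := p0; rewrite coef_poly ltn_ord valK coef0.
Qed.

Variables p q : nat.
Implicit Types (g : 'M[R]_(q.+1, p.+1)) (D : R -> R -> R -> R).

Definition gform g (a b y z : R) : R :=
  \sum_(j < q.+1) \sum_(k < p.+1) g j k * (a ^+ k * b ^+ (p - k)) * (y ^+ j * z ^+ (q - j)).

Definition is_gform D := exists g, forall x y z, D x y z = gform g (x + y) (x + z) y z.

Lemma gformD g g' a b y z : gform (g + g') a b y z = gform g a b y z + gform g' a b y z.
Proof.
rewrite /gform -big_split; apply: eq_bigr => j _; rewrite -big_split /=.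
by apply: eq_bigr => k _; rewrite mxE !mulrDl.
Qed.

Lemma gformZ c g a b y z : gform (c *: g) a b y z = c * gform g a b y z.
Proof.
rewrite /gform mulr_sumr; apply: eq_bigr => j _; rewrite mulr_sumr.
by apply: eq_bigr => k _; rewrite mxE !mulrA.
Qed.

Lemma gform0 a b y z : gform 0 a b y z = 0.
Proof. by rewrite /gform big1 // => j _; rewrite big1 // => k _; rewrite mxE !mul0r. Qed.

Lemma gform_delta j k a b y z :
  gform (delta_mx j k) a b y z = a ^+ k * b ^+ (p - k) * (y ^+ j * z ^+ (q - j)).
Proof.
rewrite /gform (bigD1 j) //= (bigD1 k) //= mxE !eqxx mul1r !big1 ?addr0 // => i /negbTE ni.
  by rewrite big1 // => l _; rewrite mxE ni !mul0r.
by rewrite mxE ni andbF !mul0r.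
Qed.

(* Rescaling the first pair of arguments meets the constraint [a - b = y - z]. *)
Lemma gform_eq0 g : (forall x y, gform g (x + y) (x + 1) y 1 = 0) -> g = 0.
Proof.
move=> h.
have h1 a y : a != 1 -> y != 1 -> gform g a 1 y 1 = 0.
  (* This [c] solves [c - 1 + y = c * a]: at [x = c - 1] the first pair of arguments is
     [(c * a, c)], and homogeneity of degree [p] removes [c]. *)
  rewrite -subr_eq0 => a1; rewrite -subr_eq0 => y1; pose c := (y - 1) / (a - 1).
  have := h (c - 1) y; rewrite subrK (_ : c - 1 + y = c * a); last by rewrite /c; field.
  rewrite (_ : gform g (c * a) c y 1 = c ^+ p * gform g a 1 y 1).
    by move/eqP; rewrite mulf_eq0 expf_eq0 mulf_eq0 invr_eq0 (negbTE a1) (negbTE y1) andbF =>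
      /eqP.
  rewrite /gform mulr_sumr; apply: eq_bigr => j _; rewrite mulr_sumr; apply: eq_bigr => k _.
  have -> : c ^+ p = c ^+ k * c ^+ (p - k) by rewrite -exprD subnKC // -ltnS.
  by rewrite !exprMn !expr1n; ring.
have h2 a j : a != 1 -> \sum_k g j k * a ^+ k = 0.
  move=> a1; move: j; apply: (@coef_fun_eq0 _ (fun j => \sum_k g j k * a ^+ k)) => y y1.
  apply: etrans (h1 a y a1 y1); apply: eq_bigr => j _.
  by rewrite mulr_suml; apply: eq_bigr => k _; rewrite !expr1n !mulr1.
by apply/matrixP => j k; rewrite mxE; move: k; apply: coef_fun_eq0 => a /h2.
Qed.

Lemma gform_inj g g' :
  (forall x y z, gform g (x + y) (x + z) y z = gform g' (x + y) (x + z) y z) -> g = g'.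
Proof.
move=> h; apply/eqP; rewrite -subr_eq0; apply/eqP/gform_eq0 => x y.
by rewrite -scaleN1r gformD gformZ h mulN1r subrr.
Qed.

Lemma is_gform_sum (I : Type) (s : seq I) (P : pred I) (D : I -> R -> R -> R -> R) :
  (forall i, P i -> is_gform (D i)) -> is_gform (fun x y z => \sum_(i <- s | P i) D i x y z).
Proof.
move=> h; elim: s => [|i s [g hg]].
  by exists 0 => x y z; rewrite big_nil gform0.
case Pi: (P i); last by exists g => x y z; rewrite big_cons Pi hg.
have [g' hg'] := h i Pi; exists (g' + g) => x y z.
by rewrite big_cons Pi hg hg' gformD.
Qed.

Lemma is_gformZ c D : is_gform D -> is_gform (fun x y z => c * D x y z).
Proof. by move=> [g hg]; exists (c *: g) => x y z; rewrite hg gformZ. Qed.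

Lemma is_gform_ext D D' : (forall x y z, D x y z = D' x y z) -> is_gform D -> is_gform D'.
Proof. by move=> e [g hg]; exists g => x y z; rewrite -e. Qed.

Lemma is_gform_monomial k j : (k <= p)%N -> (j <= q)%N ->
  is_gform (fun x y z => (x + y) ^+ (p - k) * (x + z) ^+ k * (y ^+ (q - j) * z ^+ j)).
Proof.
move=> kp jq; exists (delta_mx (inord (q - j)) (inord (p - k))) => x y z.
by rewrite gform_delta !inordK ?ltnS ?leq_subr // !subKn.
Qed.

(* [y - z = (x + y) - (x + z)] can be distributed to either pair of variables. *)
Lemma is_gform_difference k j : (k <= p)%N -> (j <= q)%N ->
  is_gform (fun x y z => (x + y) ^+ k * (y - z) ^+ (p - k) * (y ^+ j * (y - z) ^+ (q - j))).
Proof.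
move=> kp jq.
apply: (@is_gform_ext (fun x y z => \sum_(i < (p - k).+1) \sum_(l < (q - j).+1)
   ((-1) ^+ i * 'C(p - k, i)%:R * ((-1) ^+ l * 'C(q - j, l)%:R)) *
   ((x + y) ^+ (p - i) * (x + z) ^+ i * (y ^+ (q - l) * z ^+ l)))); last first.
  apply: is_gform_sum => i _; apply: is_gform_sum => l _; apply/is_gformZ/is_gform_monomial;
    have := ltn_ord i; have := ltn_ord l; lia.
move=> x y z; have -> : (y - z) ^+ (p - k) = ((x + y) - (x + z)) ^+ (p - k) by congr (_ ^+ _);
  ring.
have binomial (u v : R) N :
    (u - v) ^+ N = \sum_(i < N.+1) (-1) ^+ i * 'C(N, i)%:R * (u ^+ (N - i) * v ^+ i).
  by rewrite exprBn; apply: eq_bigr => i _; rewrite -mulr_natr; ring.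
rewrite mulrACA !binomial big_distrlr /= mulr_sumr; apply: eq_bigr => i _.
rewrite mulr_sumr; apply: eq_bigr => l _.
have -> : (p - i = k + (p - k - i))%N by have := ltn_ord i; lia.
have -> : (q - l = j + (q - j - l))%N by have := ltn_ord l; lia.
rewrite !exprD; move: ('C(p - k, i)%:R) ('C(q - j, l)%:R) ((-1) ^+ i) ((-1) ^+ l).
move: ((x + y) ^+ k) ((x + y) ^+ (p - k - i)) ((x + z) ^+ i) => e1 e2 e3.
by move: (y ^+ j) (y ^+ (q - j - l)) (z ^+ l) => *; ring.
Qed.

End Forms.

(** * The difference of two configurations *)

Section Difference.
Variable R : realType.
Variables r n : nat.
Hypothesis rn : (r <= n)%N.
Implicit Types (V W : 'M[R]_(r, n)) (g : 'M[R]_(r.+1, (n - r).+1)).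

(** In the expansion over [Q], the two coefficients cancel when [Q] has at least [r] elements; for
    smaller [Q] each is a form by itself. *)
Lemma enumerator_sub_is_form V W : general_position V -> general_position W ->
  is_gform (n - r) r (fun x y z => enumerator V x y z - enumerator W x y z).
Proof.
move=> gV gW.
have expand (U : 'M[R]_(r, n)) x y z : enumerator U x y z =
    \sum_(Q : {set 'I_n}) y ^+ #|Q| * coef_at U Q (x + y) (y - z).
  by rewrite -enumerator_expand; congr enumerator; ring.
apply: (@is_gform_ext _ _ _ (fun x y z => \sum_(Q : {set 'I_n})
    (y ^+ #|Q| * coef_at V Q (x + y) (y - z) + (-1) * (y ^+ #|Q| * coef_at W Q (x + y) (y -
      z))))).
  by move=> x y z; rewrite !expand -sumrB; apply: eq_bigr => Q _; ring.
apply: is_gform_sum => Q _; have [rQ|Qr] := leqP r #|Q|.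
  exists 0 => x y z; rewrite gform0 (coef_at_indep rn (x + y) (y - z) gV gW rQ); ring.
have small (U : 'M[R]_(r, n)) : general_position U ->
    is_gform (n - r) r (fun x y z => y ^+ #|Q| * coef_at U Q (x + y) (y - z)).
  move=> gU; have [c hc] := coef_at_small rn gU (ltnW Qr).
  apply: (@is_gform_ext _ _ _ (fun x y z => \sum_(F in FS U) c F *
      ((x + y) ^+ #|zeros F :\: Q| * (y - z) ^+ (n - r - #|zeros F :\: Q|) *
       (y ^+ #|Q| * (y - z) ^+ (r - #|Q|))))).
    by move=> x y z; rewrite hc mulr_sumr; apply: eq_bigr => F _; ring.
  apply: is_gform_sum => F FU; apply/is_gformZ/is_gform_difference; last exact: ltnW.
  by apply: leq_trans (ltnW (FS_zeros rn gU FU)); apply/subset_leq_card/subsetDl.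
have [[g hg] [g' hg']] := (small V gV, small W gW).
by exists (g + (-1) *: g') => x y z; rewrite hg hg' gformD gformZ.
Qed.

Lemma sum_rev_ord N (T : nmodType) (F : 'I_N -> T) : \sum_i F i = \sum_i F (rev_ord i).
Proof. exact: (reindex_inj rev_ord_inj). Qed.

Lemma rev_ord_subn N (k : 'I_N.+1) : (N - rev_ord k)%N = k.
Proof. by rewrite /= subSS subKn // -ltnS. Qed.

Lemma enumerator_sub_G0 V W : config0 V -> config0 W ->
  exists2 g : 'M[R]_(r.+1, (n - r).+1), G0 g & forall x y z,
    enumerator V x y z - enumerator W x y z = gform g (x + y) (x + z) y z.
Proof.
move=> [pV gV] [pW gW]; have [g hg] := enumerator_sub_is_form gV gW.
exists g => //.
(* Exchanging [y] and [z] exchanges [x + y] and [x + z], hence reverses both indices. *)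
pose g1 : 'M[R]_(r.+1, (n - r).+1) := \matrix_(j, k) g (rev_ord j) (rev_ord k).
have gform_g1 a b y z : gform g1 a b y z = gform g b a z y.
  rewrite /gform [RHS]sum_rev_ord; apply: eq_bigr => j _.
  rewrite [RHS]sum_rev_ord; apply: eq_bigr => k _.
  by rewrite mxE !rev_ord_subn /= !subSS; ring.
have E1 : g1 = g.
  apply: gform_inj => x y z; rewrite gform_g1 -!hg.
  by rewrite !(enumerator_antipode _ _ y z).
(* Replacing [x] by [- x - y - z] sends the pair [(x + y, x + z)] to [(-(x + z), -(x + y))], hence
   reverses only the index [k], up to sign. *)
pose g2 : 'M[R]_(r.+1, (n - r).+1) := \matrix_(j, k) g j (rev_ord k).
have gform_g2 a b y z : gform g2 (- a) (- b) y z = (-1) ^+ (n - r) * gform g b a y z.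
  rewrite /gform mulr_sumr; apply: eq_bigr => j _.
  rewrite mulr_sumr [RHS]sum_rev_ord; apply: eq_bigr => k _.
  rewrite mxE !rev_ord_subn /= !subSS.
  have -> : (-1) ^+ (n - r) = (-1) ^+ k * (-1) ^+ (n - r - k) :> R.
    by rewrite -exprD subnKC // -ltnS.
  by rewrite (exprNn a) (exprNn b); ring.
have E2 : g2 = - g.
  apply: gform_inj => x y z; rewrite -[x + y]opprK -[x + z]opprK gform_g2.
  have := hg (- x - y - z) y z.
  rewrite !(enumerator_dual rn) //.
  rewrite (_ : - x - y - z + y = - (x + z)); last by ring.
  rewrite (_ : - x - y - z + z = - (x + y)); last by ring.
  move=> <-; rewrite !opprK -scaleN1r gformZ -hg -mulrBr mulrA mulrN -expr2 sqrr_sign; ring.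
split=> [j k|k].
  have e1 j' k' : g j' k' = g (rev_ord j') (rev_ord k') by rewrite -{1}E1 mxE.
  have e2 j' k' : g j' k' = - g j' (rev_ord k').
    by have /matrixP /(_ j' k') := E2; rewrite !mxE => ->; rewrite opprK.
  by split; [rewrite e1 e2 rev_ordK|split].
(* At [y = 0] and [z = 1 - x] one has [x + z = 1] and only row 0 survives, with the common factor
   [(1 - x) ^+ r], nonzero off [x = 1]. *)
apply: (@coef_fun_eq0 R _ (fun k => g ord0 k)) => x x1.
have := hg x 0 (1 - x); rewrite !enumerator_pointed // subrr /gform (bigD1 ord0) //=.
rewrite [X in _ + X]big1 ?addr0; last first.
  by move=> j; rewrite -val_eqE /= => j0; rewrite big1 // => i _;
    rewrite expr0n (negbTE j0) mul0r mulr0.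
rewrite (eq_bigr (fun k => g ord0 k * x ^+ k * (1 - x) ^+ r)); last first.
  by move=> i _; rewrite (_ : x + (1 - x) = 1) ?expr1n ?subn0 ?expr0 ?mul1r ?mulr1 //; ring.
by rewrite -mulr_suml => /esym/eqP;
  rewrite mulf_eq0 expf_eq0 subr_eq0 [1 == x]eq_sym (negbTE x1) andbF orbF => /eqP.
Qed.

(** * Matrices as coefficient arrays of polynomial functions *)

Definition ev (M : 'M[R]_(n.+1, n.+1)) (x y : R) : R :=
  \sum_s \sum_t M s t * x ^+ (n - s) * y ^+ t.

Lemma evD M N x y : ev (M + N) x y = ev M x y + ev N x y.
Proof.
rewrite /ev -big_split; apply: eq_bigr => s _; rewrite -big_split; apply: eq_bigr => t _.
by rewrite mxE !mulrDl.
Qed.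

Lemma ev_inj M N : (forall x y, ev M x y = ev N x y) -> M = N.
Proof.
move=> h; apply/eqP; rewrite -subr_eq0; apply/eqP/matrixP => s t; rewrite !mxE.
suff H x : \sum_u (M (rev_ord u) t - N (rev_ord u) t) * x ^+ u = 0.
  by have := coef_fun_eq0 (fun x _ => H x) (rev_ord s); rewrite rev_ordK.
move: t; apply: (@coef_fun_eq0 _ _ (fun t => \sum_u (M (rev_ord u) t - N (rev_ord u) t) * x ^+
  u)) => y _.
apply/eqP; have /eqP := h x y; rewrite -subr_eq0; congr (_ == _).
rewrite /ev -sumrB sum_rev_ord.
transitivity (\sum_u \sum_t (M (rev_ord u) t - N (rev_ord u) t) * x ^+ u * y ^+ t).
  apply: eq_bigr => u _; rewrite -sumrB; apply: eq_bigr => t _.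
  by rewrite rev_ord_subn; ring.
by rewrite exchange_big; apply: eq_bigr => t _; rewrite mulr_suml.
Qed.

(** With bound [n], this ensures that no coefficient of [S_poly g] falls outside the matrix
    [S_map g]. *)
Definition bidegree_le (d : nat) (p : {poly {poly R}}) : Prop :=
  (size p <= d.+1)%N /\ forall t, (size (p`_t)%R <= d.+1)%N.

Lemma bidegree_leD d p q : bidegree_le d p -> bidegree_le d q -> bidegree_le d (p + q).
Proof.
move=> [p1 p2] [q1 q2]; split; first by rewrite (leq_trans (size_polyD _ _)) // geq_max p1 q1.
by move=> t; rewrite coefD (leq_trans (size_polyD _ _)) // geq_max p2 q2.
Qed.

Lemma bidegree_leM d e p q : bidegree_le d p -> bidegree_le e q -> bidegree_le (d + e) (p * q).
Proof.
have sizeM (T : idomainType) (u v : {poly T}) :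
    (size u <= d.+1 -> size v <= e.+1 -> size (u * v)%R <= (d + e).+1)%N.
  by move=> ? ?; apply: leq_trans (size_polyMleq _ _) _; lia.
move=> [p1 p2] [q1 q2]; split=> [|t]; first exact: sizeM.
by rewrite coefM (leq_trans (size_sum _ _ _)) //; apply/bigmax_leqP => i _; apply: sizeM.
Qed.

Lemma bidegree_le_exp d p k : bidegree_le d p -> bidegree_le (d * k) (p ^+ k).
Proof.
move=> h; elim: k => [|k IH]; last by rewrite exprS mulnS; apply: bidegree_leM.
by rewrite muln0 expr0; split=> [|t]; rewrite ?size_poly1 // coef1; case: (t == _);
  rewrite ?size_poly1 ?size_poly0.
Qed.

Lemma bidegree_leC d (c : {poly R}) : (size c <= d.+1)%N -> bidegree_le d c%:P.
Proof.
move=> h; split=> [|t]; first by rewrite (leq_trans (size_polyC_leq1 _)).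
by rewrite coefC; case: (t == _); rewrite ?size_poly0.
Qed.

Lemma bidegree_leX : bidegree_le 1 'X.
Proof. by split=> [|t]; rewrite ?size_polyX // coefX; case: (t == _);
  rewrite ?size_poly1 ?size_poly0. Qed.

Lemma bidegree_le_trans d e p : (d <= e)%N -> bidegree_le d p -> bidegree_le e p.
Proof. by move=> de [p1 p2]; split=> [|t]; apply: leq_trans (_ : d.+1 <= _)%N. Qed.

Lemma bidegree_le_S_poly g : bidegree_le n (S_poly g).
Proof.
have bsum (I : finType) (F : I -> {poly {poly R}}) :
    (forall i, bidegree_le n (F i)) -> bidegree_le n (\sum_i F i).
  move=> h; elim/big_ind: _ => [|p q|i _]; [|exact: bidegree_leD|exact: h].
  by split=> [|t]; rewrite ?coef0 size_poly0.
rewrite /S_poly -mulN1r; have -> : -1 = ((-1)%:P : {poly {poly R}}) by rewrite polyCN.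
apply: (@bidegree_leM 0 n); first by apply: bidegree_leC; rewrite size_polyN size_poly1.
apply: (bsum) => j; apply: (bsum) => k.
have kl := ltn_ord k; have jl := ltn_ord j.
apply: (@bidegree_le_trans (0 + 1 * k + 1 * (n - r - k) + 1 * j)); first lia.
apply: bidegree_leM; last exact/bidegree_le_exp/bidegree_leX.
apply: bidegree_leM; last by apply/bidegree_le_exp/bidegree_leC; rewrite size_XaddC.
apply: bidegree_leM; first by apply/bidegree_leC/size_polyC_leq1.
apply/bidegree_le_exp/bidegree_leD; last exact: bidegree_leX.
by apply: bidegree_leC; rewrite size_polyX.
Qed.

Lemma ev_S_map g x y : ev (S_map g) x y = - gform g (x + y) (x + 1) y 1.
Proof.
have [size1 size2] := bidegree_le_S_poly g.
transitivity (S_poly g).[y%:P].[x].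
  rewrite (horner_coef_wide _ size1) horner_sum /ev exchange_big; apply: eq_bigr => t _.
  rewrite hornerM -rmorphXn hornerC (horner_coef_wide _ (size2 t)) mulr_suml sum_rev_ord.
  by apply: eq_bigr => s _; rewrite mxE rev_ord_subn.
rewrite /S_poly hornerN hornerN !horner_sum; congr (- _); apply: eq_bigr => j _.
rewrite !horner_sum; apply: eq_bigr => k _.
rewrite !(hornerE, horner_exp) expr1n /=; ring.
Qed.

Lemma ev_fstar V x y : ev (fstar V) x y = enumerator V x y 1.
Proof.
pose neg (F : {ffun 'I_n -> option bool}) := [set i | F i == Some false].
pose pos (F : {ffun 'I_n -> option bool}) := [set i | F i == Some true].
have card3 (F : {ffun 'I_n -> option bool}) : (#|pos F| + #|neg F| + #|zeros F| = n)%N.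
  rewrite -cardsUI (_ : pos F :&: neg F = set0) ?cards0 ?addn0; last first.
    by apply/setP => i; rewrite !inE; case: (F i) => [[]|].
  have -> : pos F :|: neg F = ~: zeros F; last by rewrite addnC cardsC card_ord.
  by apply/setP => i; rewrite !inE; case: (F i) => [[]|].
(* A sign vector is recovered from its positive and negative sets, so the pairs counted by
   [fstar_entry] correspond to the vectors in [FS V]. *)
have entry s t : fstar_entry V s t =
    #|[set F in FS V | (#|neg F| == t) && (#|pos F| + t == s)%N]|.
  rewrite /fstar_entry -(card_imset _ (_ : injective (fun F => (pos F, neg F)))); last first.
    move=> F G [/setP hp /setP hn]; apply/ffunP => i; move: (hp i) (hn i); rewrite !inE.
    by case: (F i) => [[]|]; case: (G i) => [[]|].
  apply: eq_card => -[P N]; rewrite inE /=; apply/idP/imsetP.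
    move=> /andP[/andP[/asboolP [lam [l0 [Vl [/= -> ->]]]] /eqP <-] /eqP <-].
    have pE : pos (sv lam) = [set i | 0 < lam i 0].
      by apply/setP => i; rewrite !inE ffunE osg_pos.
    have nE : neg (sv lam) = [set i | lam i 0 < 0].
      by apply/setP => i; rewrite !inE ffunE osg_neg.
    exists (sv lam); last by rewrite pE nE.
    by rewrite inE pE nE !eqxx !andbT; apply/FSP; exists lam.
  move=> [F]; rewrite inE => /andP[/FSP [lam [l0 Vl Fl]] /andP[h1 h2]] [-> ->].
  rewrite h1 h2 !andbT; apply/asboolP; exists lam; split=> //; split=> //=.
  by rewrite Fl; split; apply/setP => i; rewrite !inE ffunE ?osg_pos ?osg_neg.
have term (F : {ffun 'I_n -> option bool}) : \prod_i wt x y 1 (F i) = x ^+ #|zeros F| * y ^+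
  #|neg F|.
  rewrite (bigID (mem (zeros F))) /=; congr (_ * _).
    by rewrite -prodr_const; apply: eq_bigr => i; rewrite inE => /eqP ->.
  rewrite (bigID (mem (neg F))) /= [X in _ * X]big1 ?mulr1; last first.
    by move=> i; rewrite !inE; case: (F i) => [[]|].
  rewrite -prodr_const; apply: eq_big => i; first by rewrite !inE; case: (F i) => [[]|].
  by rewrite !inE => /andP[_ /eqP ->].
rewrite /enumerator (eq_bigr _ (fun F _ => term F)).
have lt1 (F : {ffun 'I_n -> option bool}) : (n - #|zeros F| < n.+1)%N by rewrite ltnS leq_subr.
have lt2 (F : {ffun 'I_n -> option bool}) : (#|neg F| < n.+1)%N by rewrite ltnS;
  have := card3 F; lia.
rewrite (partition_big (fun F : {ffun 'I_n -> option bool} => Ordinal (lt1 F)) predT) //=;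
  apply: eq_bigr => s _.
rewrite (partition_big (fun F : {ffun 'I_n -> option bool} => Ordinal (lt2 F)) predT) //=;
  apply: eq_bigr => t _.
rewrite mxE entry -sum1dep_card natr_sum -mulrA mulr_suml.
apply: eq_big => F; last first.
  move=> /andP[_ /andP[/eqP nt /eqP ps]]; rewrite mul1r -nt; congr (x ^+ _ * _).
  by move: (card3 F) ps nt; move: #|pos F| #|neg F| #|zeros F| (s : nat) (t : nat) => *; lia.
rewrite -andbA; congr (_ && _); rewrite -!val_eqE /= andbC.
have [nt|//] := eqVneq #|neg F| (t : nat); rewrite ?andbF // !andbT.
by apply/eqP/eqP; move: (card3 F) nt;
  move: #|pos F| #|neg F| #|zeros F| (s : nat) (t : nat) => *; lia.
Qed.

(** The form of [V] minus [W] leads from [V] to [W], because [S_map] carries a minus sign. *)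
Lemma fstar_sub V W : config0 V -> config0 W ->
  exists2 g : 'M[R]_(r.+1, (n - r).+1), G0 g & fstar W = fstar V + S_map g.
Proof.
move=> cV cW; have [g gG hg] := enumerator_sub_G0 cV cW; exists g => //.
by apply: ev_inj => x y; rewrite evD !ev_fstar ev_S_map -hg; ring.
Qed.

End Difference.

(** * Mutations *)

Section Mutation.
Variable R : realType.
Variables r' n' j k : nat.
Notation r := r'.+2.
Notation n := n'.+1.
Hypothesis rn : (r < n)%N.
Hypothesis j_gt0 : (0 < j)%N.
Hypothesis jr : (j < r)%N.
Implicit Types (t : nat -> R) (e : R) (lam mu : 'cV[R]_n).

Definition side (i : nat) : R := if (i < r + k)%N then 1 else -1.
(** Chosen so that the dependency with entry 1 at column 0 and [- base_coef a] at column [a] has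
    exactly [j] negative entries among the first [r] columns. *)
Definition base_coef (a : nat) : R := if (a <= j)%N then 1 else -1.
(** The moment curve with its top power moved to coordinate 0 and multiplied by [s]; for positive
    parameters [s] thus decides the side of the hyperplane. *)
Definition curve (s x : R) (a : nat) : R := if a == 0%N then s * x ^+ r'.+1 else x ^+ a.-1.

(* The first [r] columns lie in the hyperplane where coordinate 0 vanishes, up to the
   entry [e]; at [e = 0] their unique dependency is [v_0 - \sum_a c_a v_a = 0]. *)
Definition mutant e t : 'M[R]_(r, n) := \matrix_(a < r, i < n)
  if i == 0%N :> nat then (if a == 0%N :> nat then e else base_coef a)
  else if (i < r)%N then (a == i :> nat)%:R
  else curve (side i) (t i) a.

Definition lowcol (a : 'I_r) : 'I_n := widen_ord (ltnW rn) a.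

Lemma mutant_row e t lam (a : 'I_r) : (mutant e t *m lam) a 0 =
  (if a == 0%N :> nat then e * lam 0 0 else base_coef a * lam 0 0 + lam (lowcol a) 0) +
  \sum_(i < n | (r <= i)%N) curve (side i) (t i) a * lam i 0.
Proof.
rewrite mxE (bigID (fun i : 'I_n => (i < r)%N)) /=; congr (_ + _); last first.
  apply: eq_big => [i|i]; rewrite -?leqNgt // => ri; rewrite mxE.
  by rewrite ltnNge ri; case: eqP ri => // ->.
rewrite (bigD1 ord0) //= mxE /=; case: eqP => a0.
  rewrite big1 ?addr0 // => i /andP[ir]; rewrite -val_eqE /= mxE => /negbTE i0.
  by rewrite i0 ir a0 eq_sym i0 mul0r.
congr (_ + _); rewrite (bigD1 (lowcol a)) /=; last by rewrite ltn_ord -val_eqE /=; apply/eqP.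
move/eqP/negbTE: a0 => a0; rewrite mxE /= ltn_ord a0 eqxx mul1r big1 ?addr0 //.
move=> i /andP[/andP[ir]]; rewrite -!val_eqE /= mxE => /negbTE -> /negbTE h.
by rewrite ir eq_sym h mul0r.
Qed.

Lemma mutant_affine e t lam :
  mutant e t *m lam = mutant 0 t *m lam + (e * lam 0 0) *: delta_mx 0 0.
Proof.
apply/colP => a; rewrite [RHS]mxE !mutant_row !mxE andbT -val_eqE /=.
by case: (_ == _); rewrite ?mulr1 ?mulr0 ?addr0 // mul0r add0r addrC.
Qed.

Definition low : {set 'I_n} := [set i : 'I_n | (i < r)%N].

Lemma card_low : #|low| = r.
Proof.
rewrite -[RHS]card_ord -(card_imset predT (_ : injective lowcol)); last first.
  by move=> a b /(congr1 val) /= /val_inj.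
apply: eq_card => i; rewrite inE; apply/idP/imsetP => [ir|[a _ ->]]; last by rewrite /= ltn_ord.
by exists (Ordinal ir) => //; apply: val_inj.
Qed.

(** Rows other than 0 give [lam_a = - base_coef a * lam_0] with nonzero factors, so the low
    coordinates vanish all together or not at all. *)
Lemma low_dependency e t lam : mutant e t *m lam = 0 -> lam != 0 -> supp lam \subset low ->
  supp lam = low.
Proof.
move=> Ml l0 /subsetP sl.
have hi (a : nat) : \sum_(i < n | (r <= i)%N) curve (side i) (t i) a * lam i 0 = 0.
  rewrite big1 // => i ri; case: (eqVneq (lam i 0) 0) => [->|li]; first by rewrite mulr0.
  by have := sl i; rewrite !inE li ltnNge ri => /(_ isT).
have lowE (a : 'I_r) : a != 0%N :> nat -> lam (lowcol a) 0 = - base_coef a * lam 0 0.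
  move=> /negbTE a0; have /colP /(_ a) := Ml; rewrite mutant_row a0 hi mxE addr0.
  by move/eqP; rewrite addrC addr_eq0 mulNr => /eqP.
have lam0 : lam 0 0 != 0.
  apply: contra l0 => /eqP h0; apply/eqP/colP => i; rewrite mxE; apply/eqP.
  apply: contraTT isT => li; have := sl i; rewrite !inE => /(_ li) ir.
  have [i0|i0] := eqVneq (i : nat) 0%N; first by case/eqP: li; apply: etrans h0;
    congr (lam _ 0); apply: val_inj.
  have := lowE (Ordinal ir) i0; rewrite h0 mulr0 (_ : lowcol _ = i); last exact: val_inj.
  by move/eqP; rewrite (negbTE li).
apply/eqP; rewrite eqEsubset; apply/andP; split; apply/subsetP => // i; rewrite !inE => ir.
have [i0|i0] := eqVneq (i : nat) 0%N; first by rewrite (_ : i = 0) //; exact: val_inj.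
rewrite (_ : i = lowcol (Ordinal ir)); last exact: val_inj.
rewrite lowE // mulf_neq0 // oppr_eq0 /base_coef; case: ifP; rewrite ?oppr_eq0 oner_eq0 //.
Qed.

(** Row 0 now reads [e * lam_0 = 0]. *)
Lemma low_dependency_eq e t lam : mutant e t *m lam = 0 -> supp lam \subset low -> e != 0 ->
  lam = 0.
Proof.
move=> Ml sl e0; apply/eqP/negPn/negP => l0; have s := low_dependency Ml l0 sl.
have /colP /(_ 0) := Ml; rewrite mutant_row /= mxE big1 ?addr0 => [|i ri].
  move/eqP; rewrite mulf_eq0 (negbTE e0) /=.
  have : (0 : 'I_n) \in supp lam by rewrite s inE.
  by rewrite inE => /negbTE ->.
case: (eqVneq (lam i 0) 0) => [->|li]; first by rewrite mulr0.
by have := subsetP sl i; rewrite !inE li ltnNge ri => /(_ isT).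
Qed.

(** * Generic parameters on the curve *)

Lemma annihilator (A : 'M[R]_(r, n)) (T : {set 'I_n}) : (#|T| < r)%N ->
  exists2 u : 'rV[R]_r, u != 0 & forall i, i \in T -> (u *m A) 0 i = 0.
Proof.
move=> Tr; pose B := colsub (fun l : 'I_#|T| => enum_val l) A.
have : kermx B != 0.
  by rewrite kermx_eq0 /row_free neq_ltn (leq_ltn_trans (rank_leq_col B)).
case/rowV0Pn => u /sub_kermxP uB u0; exists u => // i iT.
have /rowP /(_ (enum_rank_in iT i)) := uB; rewrite !mxE => {2}<-.
by apply: eq_bigr => a _; rewrite mxE enum_rankK_in.
Qed.

(** The coordinates of [curve] are monomials with distinct exponents, so a nonzero combination
    cannot cancel. *)
Lemma curve_poly (s : R) (u : 'rV[R]_r) : s != 0 -> u != 0 ->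
  exists2 p : {poly R}, p != 0 & forall x, p.[x] = \sum_a u 0 a * curve s x a.
Proof.
move=> s0 u0.
pose c (a : 'I_r) : R := if a == 0%N :> nat then s else 1.
pose d (a : 'I_r) : nat := if a == 0%N :> nat then r'.+1 else a.-1.
exists (\sum_a (u 0 a * c a)%:P * 'X^(d a)); last first.
  move=> x; rewrite horner_sum; apply: eq_bigr => a _.
  by rewrite hornerCM hornerXn -mulrA /c /d /curve; case: ifP; rewrite ?mul1r.
have [a ua] : exists a, u 0 a != 0.
  apply/not_existsP => h; case/eqP: u0; apply/rowP => a; rewrite mxE; apply/eqP/negPn/negP.
  exact: h.
have c0 : c a != 0 by rewrite /c; case: ifP; rewrite ?oner_eq0.
apply/eqP => /polyP /(_ (d a)); rewrite coef0 coef_sum (bigD1 a) //= coefCM coefXn eqxx mulr1.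
rewrite big1 ?addr0; first by apply/eqP; rewrite mulf_neq0.
move=> b; rewrite -val_eqE /= => ba; rewrite coefCM coefXn (_ : d a == d b = false) ?mulr0 //.
apply/eqP; rewrite /d; move: ba (ltn_ord a) (ltn_ord b);
  move: (a : nat) (b : nat) => {ua c0}a' b'.
by case: (eqVneq a' 0%N) => ?; case: (eqVneq b' 0%N) => ? /eqP ? ? ?; lia.
Qed.

Lemma side_neq0 i : side i != 0.
Proof. by rewrite /side; case: ifP; rewrite ?oppr_eq0 oner_eq0. Qed.

(** Parameters are fixed one column at a time. Each set of fewer than [r] columns is killed by a
    nonzero functional, whose value on the new column is a nonzero polynomial in the parameter;
    finitely many such polynomials have a common nonroot. *)
Lemma generic_curve : exists2 t, (forall i, 0 < t i) &
  forall lam, mutant 0 t *m lam = 0 -> (#|supp lam| <= r)%N -> lam != 0 -> supp lam = low.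
Proof.
suff H q : (r <= q <= n)%N -> exists2 t, (forall i, 0 < t i) & forall lam, mutant 0 t *m lam =
  0 ->
    (forall i : 'I_n, (q <= i)%N -> lam i 0 = 0) -> (#|supp lam| <= r)%N -> lam != 0 -> supp
      lam = low.
  have [|t t0 ht] := H n; first by rewrite (ltnW rn) leqnn.
  by exists t => // lam Ml; apply: ht => // i; rewrite leqNgt ltn_ord.
elim: q => // q IH; rewrite leq_eqVlt => /andP[/orP[/eqP rq _|rq qn]].
  exists (fun=> 1) => // lam Ml hq _ l0; apply: (low_dependency Ml l0).
  by apply/subsetP => i; rewrite !inE rq; apply: contraR; rewrite -leqNgt => /hq ->.
have [|t t0 ht] := IH; first by rewrite -ltnS rq ltnW.
pose oq : 'I_n := Ordinal qn.
(* Larger sets get the constant 1, so that the product below can run over all sets. *)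
have ex (T : {set 'I_n}) : exists p : {poly R}, p != 0 /\ ((#|T| < r)%N ->
    exists u : 'rV[R]_r, (forall i, i \in T -> (u *m mutant 0 t) 0 i = 0) /\
      forall x, p.[x] = \sum_a u 0 a * curve (side q) x a).
  have [Tr|Tr] := ltnP #|T| r; last by exists 1; rewrite oner_eq0.
  have [u u0 hu] := annihilator (mutant 0 t) Tr.
  by have [p p0 hp] := curve_poly (side_neq0 q) u0; exists p; split=> // _; exists u.
have [P hP] := choice ex.
have [|x] := @poly_nonroot R (\prod_T P T).
  by apply/prodf_neq0 => T _; have [] := hP T.
rewrite horner_prod => /prodf_neq0 hx.
pose t' i : R := if i == q then x.+2%:R else t i.
exists t' => [i|lam Ml hq sl l0]; first by rewrite /t'; case: ifP => // _; rewrite ltr0n.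
have colE (i : 'I_n) a : i != oq -> mutant 0 t' a i = mutant 0 t a i.
  by move=> /negbTE iq; rewrite !mxE /t' -[i == q :> nat]/(i == oq) iq.
(* Otherwise the functional killing the rest of the support would leave only the nonzero term at
   [oq]. *)
have lq : lam oq 0 = 0.
  apply/eqP; apply: contraTT isT => lq.
  have [_ h] := hP (supp lam :\ oq).
  have [|u [hu hp]] := h.
    by move: sl; rewrite (cardsD1 oq) inE lq.
  have : (u *m mutant 0 t' *m lam) 0 0 = 0 by rewrite -mulmxA Ml mulmx0 mxE.
  rewrite mxE (bigD1 oq) //= [X in _ + X]big1 ?addr0.
    move/eqP; rewrite mulf_eq0 (negbTE lq) orbF mxE => /eqP h0;
      case/negP: (hx (supp lam :\ oq) isT).
    rewrite hp -[X in _ == X]h0; apply/eqP/eq_bigr => a _; rewrite mxE.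
    rewrite /=; have -> : (q == 0)%N = false by apply/eqP => q0; move: rq; rewrite q0.
    by rewrite ltnNge -ltnS rq /t' eqxx.
  move=> i iq; case: (eqVneq (lam i 0) 0) => [->|li]; first by rewrite mulr0.
  have -> : (u *m mutant 0 t') 0 i = (u *m mutant 0 t) 0 i.
    rewrite [LHS]mxE [RHS]mxE; apply: eq_bigr => a _; rewrite colE //.
  by rewrite hu ?mul0r // !inE iq li.
apply: ht => // [|i].
  rewrite -Ml; apply/colP => a; rewrite [LHS]mxE [RHS]mxE; apply: eq_bigr => i _.
  by have [->|iq] := eqVneq i oq; rewrite ?lq ?mulr0 // colE.
rewrite leq_eqVlt => /orP[/eqP iq|]; last exact: hq.
by rewrite -lq; congr (lam _ 0); apply: val_inj.
Qed.

(** Only one entry contains [e]; in the expansion along its column all cofactors are free of [e]. *)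
Lemma det_mutant_affine t (f : 'I_r -> 'I_n) : injective f -> exists E, forall e,
  \det (colsub f (mutant e t)) = \det (colsub f (mutant 0 t)) + e * E.
Proof.
move=> fi; case: (pselect (exists k0, f k0 = 0)) => [[k0 fk]|nf]; last first.
  exists 0 => e; rewrite mulr0 addr0; congr (\det _); apply/matrixP => a l.
  by rewrite !mxE; case: eqP => // fl; case: nf; exists l; apply: val_inj.
exists (cofactor (colsub f (mutant 0 t)) 0 k0) => e.
have cof a : cofactor (colsub f (mutant e t)) a k0 = cofactor (colsub f (mutant 0 t)) a k0.
  congr (_ * \det _); apply/matrixP => b l; rewrite !mxE; case: eqP => // fl.
  have : f (lift k0 l) = f k0 by rewrite fk; apply: val_inj.
  by move/fi/eqP; rewrite eq_sym (negbTE (neq_lift _ _)).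
rewrite !(expand_det_col _ k0) (bigD1 0) // [in RHS](bigD1 0) //= !mxE fk /= mul0r add0r cof
  addrC.
congr (_ + _); apply: eq_bigr => a a0; rewrite !mxE fk /= cof.
by rewrite -val_eqE /= in a0; rewrite (negbTE a0).
Qed.

(** Minors that are nonzero at [e = 0] stay so for small [e]. A minor vanishing at [e = 0] comes
    from a dependency on its columns, which by hypothesis are the low ones, and there
    [low_dependency] applies. *)
Lemma mutant_generic t :
  (forall lam, mutant 0 t *m lam = 0 -> (#|supp lam| <= r)%N -> lam != 0 -> supp lam = low) ->
  exists2 d, 0 < d & forall e, `|e| <= d -> forall lam, mutant e t *m lam = 0 ->
    (#|supp lam| <= r)%N -> lam != 0 -> supp lam = low.
Proof.
move=> ht.
have [f|d d0 hd] := @uniformly_small R {ffun 'I_r -> 'I_n} (fun f d => injective f ->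
    \det (colsub f (mutant 0 t)) != 0 -> forall e, `|e| <= d -> \det (colsub f (mutant e t)) !=
      0).
  case: (pselect (injective f)) => [fi|]; last by exists 1.
  have [E hE] := det_mutant_affine t fi.
  have [D0|D0] := eqVneq (\det (colsub f (mutant 0 t))) 0.
    by exists 1 => // ? _ _ /eqP; case.
  have Dp : 0 < `|\det (colsub f (mutant 0 t))| by rewrite normr_gt0.
  have Ep : 0 < `|E| + 1 by rewrite ltr_pwDr.
  exists (`|\det (colsub f (mutant 0 t))| / (`|E| + 1)); first by rewrite divr_gt0.
  move=> d /andP[d0 dD] _ _ e ed; rewrite hE; move: dD; rewrite ler_pdivlMr // => dD.
  have : `|e * E| < `|\det (colsub f (mutant 0 t))|.
    rewrite normrM; apply: lt_le_trans dD; apply: (@le_lt_trans _ _ (d * `|E|)).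
      by rewrite ler_wpM2r.
    by rewrite ltr_pM2l // ltrDl.
  apply: contraTneq => /eqP; rewrite addrC addr_eq0 => /eqP ->; by rewrite normrN ltxx.
exists d => // e ed lam Ml sl l0.
have [f fi hf] := injection_covering sl (ltnW rn).
have hs i : lam i 0 != 0 -> exists l, f l = i by move=> li; apply: hf; rewrite inE.
pose F := finfun f.
have FE : f = F by apply/funext => l; rewrite ffunE.
have [D0|D0] := eqVneq (\det (colsub f (mutant 0 t))) 0; last first.
  case/eqP: l0; apply: (colsub_regular fi _ hs Ml); rewrite FE.
  by apply: (hd d) => //; rewrite ?d0 ?lexx // -FE.
apply: (low_dependency Ml l0).
have [mu [mu0 Mmu hmu]] := colsub_singular fi D0.
have lowmu := ht mu Mmu (card_supp_image hmu) mu0.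
have -> : low = f @: setT.
  apply/eqP; rewrite eqEcard card_low card_imset // cardsT card_ord leqnn andbT -lowmu.
  by apply/subsetP => i; rewrite inE => /hmu [l <-]; apply: imset_f.
by apply/subsetP => i; rewrite inE => /hs [l <-]; apply: imset_f.
Qed.

Definition signed (b : bool) : R := if b then 1 else -1.

Lemma osg_signed (a : R) b : (osg a == Some b) = (0 < signed b * a).
Proof. by case: b; rewrite ?osg_pos ?osg_neg /signed ?mul1r // mulN1r oppr_gt0. Qed.

Lemma signed_sqr b : signed b * signed b = 1.
Proof. by rewrite /signed; case: b; rewrite ?mulrNN mul1r. Qed.

Lemma signed_neq0 b : signed b != 0.
Proof. by case: b; rewrite /signed ?oppr_eq0 oner_neq0. Qed.

Lemma signedN b : signed (~~ b) = - signed b.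
Proof. by case: b; rewrite /signed ?opprK. Qed.

Lemma signed_eq b c : signed (b == c) = signed b * signed c.
Proof. by rewrite /signed; case: b; case: c; rewrite ?mulrNN ?mul1r ?mulr1. Qed.

Lemma sideE i : side i = signed (i < r + k)%N.
Proof. by []. Qed.

(** * Sign vectors lost and gained in a mutation *)

Section SmallMutation.
Variables (t : nat -> R) (e : R).
Hypothesis t_gt0 : forall i, 0 < t i.
Hypothesis e_gt0 : 0 < e.
Hypothesis gen : forall e', `|e'| <= e -> forall lam, mutant e' t *m lam = 0 ->
    (#|supp lam| <= r)%N -> lam != 0 -> supp lam = low.
Hypothesis small : forall (i : 'I_n) a, (a < r'.+1)%N -> e * t i ^+ a < t i ^+ r'.+1.

Definition mut (eta : bool) : 'M[R]_(r, n) := mutant (signed eta * e) t.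

Lemma norm_signed eta : `|signed eta * e| <= e.
Proof. by rewrite normrM /signed; case: eta; rewrite ?normrN normr1 mul1r gtr0_norm. Qed.

Lemma mut_general_position eta : general_position (mut eta).
Proof.
apply: general_position_dep => lam Ml sl; apply/eqP/negPn/negP => l0.
case/eqP: (l0); apply: (low_dependency_eq Ml); first by rewrite (gen (norm_signed eta) Ml sl l0).
by rewrite mulf_neq0 ?signed_neq0 ?gt_eqF.
Qed.

(** The functional ignores coordinate 0, so neither [e] nor the sides matter. At column 0 the weight
    [r] on coordinate 1, where [base_coef] is 1 because [0 < j], outweighs the other entries; all
    other columns are nonnegative off coordinate 0. *)
Lemma mut_pointed eta : pointed (mut eta).
Proof.
pose o1 : 'I_r := Ordinal (isT : (1 < r)%N).
pose u (a : 'I_r) : R := if a == 0%N :> nat then 0 else if a == o1 then r%:R else 1.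
have u_ge0 a : 0 <= u a by rewrite /u; case: ifP => // _; case: ifP.
exists u; split; first by exists o1; rewrite /u /= ?eqxx pnatr_eq0.
move=> i; case: (posnP i) => i0; last case: (ltnP i r) => ir.
- rewrite (bigD1 o1) //= mxE i0 /= /u /= ?eqxx /base_coef j_gt0 mulr1.
  apply: (@lt_le_trans _ _ (r%:R + \sum_(a : 'I_r | a != o1) -1)).
    by rewrite sumr_const cardC1 card_ord mulNrn subr_gt0 ltr_nat.
  rewrite lerD2l; apply: ler_sum => a /negbTE a1; rewrite mxE i0 a1 /= /base_coef.
  by case: ifP => _; rewrite ?mul0r ?mul1r; [|case: ifP => _]; lra.
- rewrite (bigD1 (Ordinal ir)) //= mxE gtn_eqF //= ir eqxx mulr1 ltr_wpDr //.
    by apply: sumr_ge0 => a _; rewrite mxE gtn_eqF // ir mulr_ge0.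
  by rewrite /u /= gtn_eqF //; case: ifP; rewrite ?ltr0n.
- rewrite (bigD1 o1) //= mxE gtn_eqF // ltnNge ir /= /curve /= expr0 mulr1 ltr_wpDr //.
    apply: sumr_ge0 => a _; rewrite mxE gtn_eqF // ltnNge ir /= /curve /u.
    case: ifP => a0; first by rewrite mul0r.
    by rewrite mulr_ge0 ?exprn_ge0 ?ltW //; case: ifP.
Qed.

(* The segment between the two normalized circuits stays among dependencies of
   [mutant e' t] with [|e'| <= e], so no coordinate can change sign along it. *)
Lemma mut_switch eta lam : mut eta *m lam = 0 -> #|supp lam| = r.+1 -> ~~ (low \subset supp
  lam) ->
  exists2 mu, mut (~~ eta) *m mu = 0 & sv mu = sv lam.
Proof.
move=> Ml sl nlow; have [l0|l0] := eqVneq (lam 0 0) 0.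
  by exists lam => //; rewrite -Ml /mut mutant_affine [RHS]mutant_affine l0 !mulr0.
have An : (#|0%R |: ~: supp lam| <= n - r)%N.
  rewrite cardsU1; have := cardsC (supp lam); rewrite sl card_ord; move: #|~: supp lam| => q.
  by case: (_ \notin _) => /=; lia.
have [mu Mmu hmu] := dependency_free (fun i => (i == 0)%:R * lam 0 0) (ltnW rn)
  (mut_general_position (~~ eta)) An.
have mu0 : mu 0 0 = lam 0 0 by rewrite hmu ?setU11 // eqxx mul1r.
have muC i : lam i 0 = 0 -> mu i 0 = 0.
  move=> li; rewrite hmu ?inE ?li ?eqxx ?orbT //.
  by have [i0|_] := eqVneq i 0; rewrite ?mul0r // -i0 li mulr0.
exists mu => //; apply/ffunP => i; rewrite !ffunE.
have [li|li] := eqVneq (lam i 0) 0; first by rewrite li muC.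
apply/eqP; apply/negPn/negP => ne.
(* The point of the segment from [lam] to [mu] where coordinate [i], of different signs at the two
   ends, vanishes. *)
pose s := `|lam i 0| / (`|lam i 0| + `|mu i 0|).
have lp : 0 < `|lam i 0| by rewrite normr_gt0.
have dp : 0 < `|lam i 0| + `|mu i 0| by rewrite ltr_wpDr.
have s0 : 0 <= s by rewrite divr_ge0 ?ltW.
have s1 : s <= 1 by rewrite ler_pdivrMr // mul1r lerDl.
pose nu := (1 - s) *: lam + s *: mu.
have nuE l : nu l 0 = (1 - s) * lam l 0 + s * mu l 0 by rewrite !mxE.
have nu0 : nu 0 0 = lam 0 0 by rewrite nuE mu0; ring.
have nui : nu i 0 = 0.
  have -> : nu i 0 = (`|mu i 0| * lam i 0 + `|lam i 0| * mu i 0) / (`|lam i 0| + `|mu i 0|).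
    by rewrite nuE /s; field; rewrite gt_eqF.
  rewrite (_ : _ + _ = 0) ?mul0r //; move: ne.
  have [m|m|->] := ltgtP (mu i 0) 0; last by rewrite normr0 mul0r mulr0 addr0.
    have [l|l|l] := ltgtP (lam i 0) 0; last by rewrite l eqxx in li.
      have /eqP -> : osg (mu i 0) == Some false by rewrite osg_neg.
      by rewrite eq_sym osg_neg l.
    by move=> _; rewrite (ltr0_norm m) (gtr0_norm l); ring.
  have [l|l|l] := ltgtP (lam i 0) 0; last by rewrite l eqxx in li.
    by move=> _; rewrite (gtr0_norm m) (ltr0_norm l); ring.
  have /eqP -> : osg (mu i 0) == Some true by rewrite osg_pos.
  by rewrite eq_sym osg_pos l.
have subs : supp nu \subset supp lam :\ i.
  apply/subsetP => l; rewrite !inE nuE; have [->|li'] := eqVneq l i;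
    first by rewrite -nuE nui eqxx.
  by apply: contraNneq => h; rewrite h muC // !mulr0 addr0.
(* Coordinate 0 is constant along the segment, so the entry [e] interpolates linearly between
   [signed eta * e] and its negative. *)
have Mnu : mutant ((1 - s - s) * (signed eta * e)) t *m nu = 0.
  rewrite mutant_affine nu0 mulmxDr -!scalemxAr.
  have /eqP := Ml; rewrite /mut mutant_affine addr_eq0 => /eqP ->.
  have /eqP := Mmu; rewrite /mut mutant_affine addr_eq0 mu0 => /eqP ->.
  rewrite signedN -!scaleNr !scalerA -!scalerDl; apply/eqP; rewrite scaler_eq0; apply/orP; left.
  by apply/eqP; ring.
have low_nu : supp nu = low.
  apply: (gen _ Mnu).
  - rewrite normrM; apply: le_trans (norm_signed eta); rewrite ler_piMl // ler_norml; lra.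
  - apply: leq_trans (subset_leq_card subs) _; by move: sl;
    rewrite (cardsD1 i) inE li add1n => -[->].
  - by apply: contra l0 => /eqP h; rewrite -nu0 h mxE.
by case/negP: nlow; rewrite -low_nu (subset_trans subs) // subsetDl.
Qed.

(** The signs of the unique low dependency at [e = 0], normalized to be positive at column 0. *)
Definition low_sign (l : nat) : bool := (l == 0%N) || (j < l)%N.
(** The sign a high column must carry to balance row 0 when coordinate 0 of the dependency has sign
    [rho]. *)
Definition high_sign (eta rho : bool) (i : nat) : bool := ~~ ((eta == rho) == (i < r + k)%N).

Lemma high_signE eta rho i : signed (high_sign eta rho i) = - (signed eta * signed rho * side i).
Proof. by rewrite signedN !signed_eq. Qed.

(** Once coordinate 0 is normalized, row 0 determines the entry [x] at [i] and the other rows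
    determine the low entries. These differ from the dependency at [e = 0] by a correction too small
    to change signs. *)
Lemma circuit eta rho (i : 'I_n) : (r <= i)%N -> exists lam,
  [/\ mut eta *m lam = 0, lam 0 0 = signed rho,
     forall l : 'I_n, (r <= l)%N -> l != i -> lam l 0 = 0,
     forall l : 'I_n, (l < r)%N -> osg (lam l 0) = Some (low_sign l == rho) &
     osg (lam i 0) = Some (high_sign eta rho i)].
Proof.
move=> ri; have tp m : 0 < t i ^+ m by rewrite exprn_gt0.
have tn : t i ^+ r'.+1 != 0 by rewrite gt_eqF.
pose x := - (signed eta * e * side i * signed rho) / t i ^+ r'.+1.
pose lam : 'cV[R]_n := \col_l if l == 0%N :> nat then signed rho
  else if (l < r)%N then - base_coef l * signed rho - t i ^+ l.-1 * x
  else if l == i then x else 0.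
have i0 : (i == 0%N :> nat) = false by apply/eqP => h; rewrite h in ri.
have ir : (i < r)%N = false by rewrite ltnNge ri.
have lam_i : lam i 0 = x by rewrite mxE i0 ir eqxx.
have lam_hi (l : 'I_n) : (r <= l)%N -> l != i -> lam l 0 = 0.
  move=> rl /negbTE li; rewrite mxE li ltnNge rl /=.
  by case: eqP rl => // ->.
exists lam; split=> //.
- apply/colP => a; rewrite mutant_row (bigD1 i) //= big1 ?addr0; last first.
    by move=> l /andP[rl li]; rewrite lam_hi ?mulr0.
  rewrite lam_i [RHS]mxE /curve; case: eqP => a0.
    rewrite mxE /= /x; transitivity (signed eta * e * signed rho * (1 - side i * side i)).
      by field.
    by rewrite sideE signed_sqr subrr mulr0.
  rewrite !mxE /= ltn_ord; case: eqP => // _; ring.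
- by rewrite mxE.
- move=> l lr; apply/eqP; rewrite osg_signed signed_eq mxE lr.
  case: eqP => [->|/eqP l0]; first by rewrite /low_sign eqxx mul1r signed_sqr.
  have sl : signed (low_sign l) = - base_coef l.
    by rewrite /low_sign (negbTE l0) /base_coef /signed /=; case: (leqP l j); rewrite ?opprK.
  rewrite -sl; have -> : signed (low_sign l) * signed rho * (signed (low_sign l) * signed rho -
    t i ^+ l.-1 * x)
     = 1 - signed (low_sign l == rho) * (t i ^+ l.-1 * x).
    rewrite signed_eq mulrBr; congr (_ - _); rewrite mulrACA !signed_sqr mulr1 //.
  (* The correction is below 1 in absolute value by [small]. *)
  rewrite subr_gt0; apply: le_lt_trans (ler_norm _) _.
  have ns b : `|signed b| = 1 by case: b; rewrite /signed ?normrN normr1.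
  rewrite !normrM ns mul1r normrN !normrM sideE !ns mul1r !mulr1 normfV.
  rewrite !gtr0_norm // mulrA ltr_pdivrMr // mul1r mulrC small //.
  by move: l0 lr; case: (l : nat).
- apply/eqP; rewrite osg_signed lam_i high_signE /x.
  rewrite (_ : _ * _ = (signed eta * signed eta) * (signed rho * signed rho) * (side i * side
    i) * (e / t i ^+ r'.+1)); last by field.
  by rewrite !signed_sqr !mul1r divr_gt0.
Qed.

(** These turn out to be the vectors realized on one side of the mutation only: they lie above
    circuits through all low columns, and all their high entries balance row 0 in the same
    direction. *)
Definition special (eta rho : bool) (F : {ffun 'I_n -> option bool}) : bool :=
  [forall l : 'I_n, if (l < r)%N then F l == Some (low_sign l == rho)
     else (F l == None) || (F l == Some (high_sign eta rho l))] &&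
  [exists l : 'I_n, (r <= l)%N && (F l != None)].

(** The circuit through any nonzero high coordinate of [F] lies below [F]. *)
Lemma special_in eta rho F : special eta rho F -> F \in FS (mut eta).
Proof.
case/andP=> /forallP hF /existsP [i /andP[ri Fi]].
have [lam [Ml l0 lhi llo li]] := circuit eta rho ri.
apply: (FS_conformal (ltnW rn) (mut_general_position eta)) (_ : sv lam \in _) _.
  apply/FSP; exists lam; split=> //.
  by apply/eqP => h; have := signed_neq0 rho; rewrite -l0 h mxE eqxx.
apply/forallP => l; rewrite ffunE; have := hF l; case: ifPn => [lr /eqP ->|].
  by rewrite llo // eqxx orbT.
rewrite -leqNgt => rl; have [->|ne] := eqVneq l i; last by rewrite lhi // /osg eqxx.
by rewrite (negbTE Fi) /= => /eqP ->; rewrite li eqxx orbT.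
Qed.

(** In row 0 of the opposite configuration all terms have the same weak sign and the one at column 0
    is nonzero, so they cannot cancel. *)
Lemma special_notin eta rho F : special eta rho F -> F \notin FS (mut (~~ eta)).
Proof.
case/andP=> /forallP hF _; apply/negP => /FSP [lam [_ Ml Fl]].
have /colP /(_ 0) := Ml; rewrite mutant_row /= mxE => /eqP; apply/negP.
rewrite -(mulrI_eq0 _ (mulfI (signed_neq0 (~~ eta == rho)))) gt_eqF // mulrDr mulr_sumr.
rewrite ltr_wpDr //; last first.
  rewrite signed_eq; have := hF 0; rewrite /= Fl ffunE osg_signed signed_eq mul1r => l0.
  rewrite [X in 0 < X](_ : _ = (signed (~~ eta) * signed (~~ eta)) * (e * (signed rho * lam 0
    0))); last by ring.
  by rewrite signed_sqr mul1r mulr_gt0.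
apply: sumr_ge0 => i ri; have := hF i; rewrite ltnNge ri /= Fl ffunE osg_None => /orP[/eqP->|].
  by rewrite !mulr0.
rewrite osg_signed high_signE signed_eq signedN /curve /= => h.
rewrite [X in 0 <= X](_ : _ = t i ^+ r'.+1 * (- (signed eta * signed rho * side i) * lam i 0));
  last by ring.
by rewrite ltW // mulr_gt0 // exprn_gt0.
Qed.

(** Take a circuit below [F]. If it missed a low column, [mut_switch] would carry it to the other
    side; hence it consists of the low columns and one high column, and is given by [circuit]. *)
Lemma special_only eta F : F \in FS (mut eta) -> F \notin FS (mut (~~ eta)) ->
  exists rho, special eta rho F.
Proof.
move=> FV FW; have gV := mut_general_position eta; have gW := mut_general_position (~~ eta).
have [lam [Ml clF sl]] := FS_circuit (ltnW rn) gV FV.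
have l0 : lam != 0.
  apply/eqP => h; suff s0 : supp lam = set0 by rewrite s0 cards0 in sl.
  by apply/setP => i; rewrite !inE h mxE eqxx.
have [lowl|nlow] := boolP (low \subset supp lam); last first.
  case/negP: FW; have [mu Mmu smu] := mut_switch Ml sl nlow.
  apply: (FS_conformal (ltnW rn) gW (_ : sv mu \in _)); last by rewrite smu.
  apply/FSP; exists mu; split=> //; by rewrite -sv_eq0 smu sv_eq0.
have [i ri] : exists i, i \in supp lam :\: low.
  by apply/set0Pn; rewrite -card_gt0 cardsD (setIidPr lowl) sl card_low; lia.
have one : supp lam :\: low = [set i].
  apply/eqP; rewrite eq_sym eqEcard sub1set ri cards1 cardsD (setIidPr lowl) sl card_low; lia.
have rl : (r <= i)%N by move: ri; rewrite !inE -leqNgt => /andP[].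
have lam0 : lam 0 0 != 0 by have := subsetP lowl 0; rewrite !inE; apply.
pose rho := 0 < lam 0 0.
have rhoE : lam 0 0 = `|lam 0 0| * signed rho.
  by rewrite /rho /signed; case: ifPn; [move=> h;
    rewrite gtr0_norm // mulr1|rewrite -leNgt => h; rewrite ler0_norm // mulrNN mulr1].
have [mu [Mmu mu0 muhi mulo mui]] := circuit eta rho rl.
(* Both are dependencies on [low] and [i]; the difference vanishes at column 0, so its support has
   at most [r] elements. *)
have lamE : lam = `|lam 0 0| *: mu.
  apply/eqP; rewrite -subr_eq0; apply/eqP/(dependency_large (ltnW rn) gV).
    by rewrite mulmxBr Ml -scalemxAr Mmu scaler0 subr0.
  apply: (@leq_trans #|(low :\ 0) :|: [set i]|).
    apply/subset_leq_card/subsetP => l; rewrite !inE !mxE.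
    have [->|li] := eqVneq l i; first by rewrite orbT.
    have [->|l0'] := eqVneq l 0; first by rewrite mu0 -rhoE subrr eqxx.
    case: ltnP => //= rl' ; rewrite muhi // mulr0 subr0 => ll.
    have : l \in supp lam :\: low by rewrite !inE -leqNgt rl' ll.
    by rewrite one inE (negbTE li).
  rewrite cardsU cards1 (leq_trans (leq_subr _ _)) // addn1.
  by have := cardsD1 (0 : 'I_n) low; rewrite inE /= add1n card_low => ->.
have lp : 0 < `|lam 0 0| by rewrite normr_gt0.
exists rho; apply/andP; split; last first.
  apply/existsP; exists i; rewrite rl /=; have := forallP clF i; rewrite ffunE.
  have : lam i 0 != 0 by move: ri; rewrite !inE => /andP[].
  by rewrite -osg_None => /negbTE n0; rewrite n0 /= => /eqP <-; rewrite n0.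
apply/forallP => l; case: ifPn => [lr|].
  by have := forallP clF l; rewrite ffunE lamE mxE osgM // mulo // => /= /eqP <-.
rewrite -leqNgt => rl'; case Fl: (F l) => [b|] //=.
rewrite -[Some b == _]/(b == _); case: (eqVneq b (high_sign eta rho l)) => // ne.
(* A wrong high sign would place the opposite configuration's circuit through [l] below [F]. *)
have be : b = high_sign (~~ eta) rho l.
  by move: ne; rewrite /high_sign; case: b {Fl}; case: (eta); case: (rho); case: (_ < _)%N.
case/negP: FW; have [nu [Mnu nu0 nuhi nulo nul]] := circuit (~~ eta) rho rl'.
apply: (FS_conformal (ltnW rn) gW (_ : sv nu \in _)).
  apply/FSP; exists nu; split=> //.
  by apply/eqP => h; have := signed_neq0 rho; rewrite -nu0 h mxE eqxx.
apply/forallP => m; rewrite ffunE; have [mr|rm] := ltnP m r.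
  have := forallP clF m; rewrite ffunE lamE mxE osgM // mulo // nulo //.
have [->|ml] := eqVneq m l; last by rewrite nuhi // /osg eqxx.
by rewrite nul Fl -be eqxx orbT.
Qed.

Lemma special_rho eta F : special eta true F -> special eta false F = false.
Proof.
case/andP=> /forallP /(_ 0) /= /eqP F0 _; apply/negP => /andP[/forallP /(_ 0)].
by rewrite /= F0.
Qed.

Lemma specialE eta F : (F \in FS (mut eta)) && (F \notin FS (mut (~~ eta))) =
  special eta true F || special eta false F.
Proof.
apply/andP/orP => [[FV FW]|].
  by have [[]] := special_only FV FW; [left|right].
by case=> h; split; [exact: special_in h|exact: special_notin h|exact: special_in h|exact:
  special_notin h].
Qed.

Section Weights.
Variables x y z : R.

Definition special_weight (eta rho : bool) (l : nat) : R :=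
  if (l < r)%N then wt x y z (Some (low_sign l == rho)) else x + wt x y z (Some (high_sign eta
    rho l)).

(** Accounts for the vector with all high entries zero; it does not depend on [eta] and cancels
    between the two sides. *)
Definition degenerate_weight (rho : bool) (l : nat) : R :=
  if (l < r)%N then wt x y z (Some (low_sign l == rho)) else x.

(** Without the existence clause of [special] the coordinates are chosen independently and the sum
    factors; the subtracted product is the one excluded vector. *)
Lemma sum_special eta rho : \sum_(F | special eta rho F) \prod_i wt x y z (F i) =
  \prod_(l < n) special_weight eta rho l - \prod_(l < n) degenerate_weight rho l.
Proof.
pose Q (l : 'I_n) : pred (option bool) := fun u => if (l < r)%N then u == Some (low_sign l == rho)
     else (u == None) || (u == Some (high_sign eta rho l)).
have -> : \prod_(l < n) special_weight eta rho l = \sum_(F in family Q) \prod_i wt x y z (F i).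
  rewrite -(bigA_distr_big_dep Q (fun _ u => wt x y z u)); apply: eq_bigr => l _;
    rewrite /special_weight big_mkcond sum_osign /Q.
  case: ifP => _ /=; first by case: (_ == rho); rewrite /= ?add0r ?addr0.
  by case: high_sign; rewrite /= ?add0r ?addr0.
pose F0 : {ffun 'I_n -> option bool} := [ffun l : 'I_n => if (l < r)%N then Some (low_sign l ==
  rho) else None].
apply/eqP; rewrite eq_sym subr_eq; apply/eqP.
rewrite (bigID (fun F : {ffun 'I_n -> option bool} => [exists l : 'I_n, (r <= l)%N && (F l !=
  None)])) /=.
congr (_ + _); rewrite (big_pred1 F0).
  by apply: eq_bigr => l _; rewrite ffunE /degenerate_weight; case: ifP.
move=> F; apply/andP/eqP => [[/familyP hF /existsPn nF]|->].
  apply/ffunP => l; rewrite ffunE; have : Q l (F l) := hF l; have := nF l; rewrite /Q.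
  by case: (ltnP l r) => [_ _ /eqP //|_ /= /negPn /eqP].
split; last by apply/existsPn => l; rewrite ffunE; case: (ltnP l r).
apply/familyP => l; suff : Q l (F0 l) by [].
by rewrite /Q ffunE; case: (l < r)%N; rewrite ?eqxx.
Qed.

Hypothesis kn : (k <= n - r)%N.

Lemma prod_special_weight eta rho : \prod_(l < n) special_weight eta rho l =
  wt x y z (Some rho) ^+ (r - j) * wt x y z (Some (~~ rho)) ^+ j *
  ((x + wt x y z (Some (eta != rho))) ^+ k * (x + wt x y z (Some (eta == rho))) ^+ (n - r - k)).
Proof.
have seg a b (c : R) : (forall l, (a <= l < b)%N -> special_weight eta rho l = c) ->
    \prod_(a <= l < b) special_weight eta rho l = c ^+ (b - a).
  by move=> h; rewrite -prodr_const_nat; apply: eq_big_nat.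
rewrite -(big_mkord xpredT (special_weight eta rho)).
(* The range is cut where the weight changes: column 0, the low columns of either coefficient, the
   high columns of either side. *)
rewrite (@big_cat_nat _ _ _ 1%N) //= (@big_cat_nat _ _ _ j.+1 1%N) //=;
  last exact: leq_trans jr (ltnW rn).
rewrite (@big_cat_nat _ _ _ r j.+1) //=; last exact: ltnW.
rewrite (@big_cat_nat _ _ _ (r + k)%N r) //= ?leq_addr //; last by rewrite -leq_subRL // ltnW.
rewrite (@seg 0%N 1%N (wt x y z (Some rho))); last first.
  by case=> // _; rewrite /special_weight /low_sign /=; case: (rho).
rewrite (@seg 1%N j.+1 (wt x y z (Some (~~ rho)))); last first.
  move=> l /andP[l0 lj]; rewrite /special_weight /low_sign (leq_ltn_trans _ jr) //.
  by rewrite gtn_eqF // ltnNge -ltnS lj; case: (rho).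
rewrite (@seg j.+1 r (wt x y z (Some rho))); last first.
  by move=> l /andP[jl lr]; rewrite /special_weight /low_sign lr jl orbT; case: (rho).
rewrite (@seg r (r + k)%N (x + wt x y z (Some (eta != rho)))); last first.
  move=> l /andP[rl lr]; rewrite /special_weight ltnNge rl /high_sign lr /=.
  by case: (eta); case: (rho).
rewrite (@seg (r + k)%N n (x + wt x y z (Some (eta == rho)))); last first.
  move=> l /andP[rl lr]; rewrite /special_weight ltnNge (leq_trans (leq_addr k r)) //=
    /high_sign ltnNge rl.
  by case: (eta); case: (rho).
have -> : (r + k - r = k)%N by lia.
have -> : (n - (r + k) = n - r - k)%N by lia.
have -> : (r - j = (r - j.+1).+1)%N by lia.
rewrite subn0 expr1 subn1 exprS /=; move: (r - j.+1)%N (n - r - k)%N => u v; ring.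
Qed.

Lemma enumerator_mut_sub : enumerator (mut true) x y z - enumerator (mut false) x y z =
  (y ^+ j * z ^+ (r - j) - y ^+ (r - j) * z ^+ j) *
  ((x + y) ^+ k * (x + z) ^+ (n - r - k) - (x + y) ^+ (n - r - k) * (x + z) ^+ k).
Proof.
have split_common eta : enumerator (mut eta) x y z =
    \sum_(F in FS (mut true) :&: FS (mut false)) \prod_i wt x y z (F i) +
    \sum_rho (\prod_(l < n) special_weight eta rho l - \prod_(l < n) degenerate_weight rho l).
  rewrite /enumerator (bigID (mem (FS (mut (~~ eta))))) /=; congr (_ + _).
    by apply: eq_bigl => F; rewrite in_setI; case: (eta); rewrite // andbC.
  rewrite (eq_bigl _ _ (specialE eta)) big_bool -!sum_special.
  rewrite (bigID (special eta true)) /=; congr (_ + _); apply: eq_bigl => F.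
    by case: (special eta true F); rewrite ?andbT ?andbF.
  by case h: (special eta true F); rewrite ?andbT ?andbF //= (special_rho h).
rewrite !split_common !big_bool !prod_special_weight /=; ring.
Qed.

End Weights.

End SmallMutation.

End Mutation.

(** * Dimension count *)

Section Span.
Variable R : realType.

Lemma exists_mutation (r n j k : nat) : (1 < r < n)%N -> (0 < j < r)%N -> (k <= n - r)%N ->
  exists V W : 'M[R]_(r, n), [/\ config0 V, config0 W & forall x y z,
    enumerator V x y z - enumerator W x y z =
    (y ^+ j * z ^+ (r - j) - y ^+ (r - j) * z ^+ j) *
    ((x + y) ^+ k * (x + z) ^+ (n - r - k) - (x + y) ^+ (n - r - k) * (x + z) ^+ k)].
Proof.
case: r => [|[|r']]; case: n => [|n'] // rn /andP[j0 jr] kn.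
have [t t0 ht] := @generic_curve R r' n' j k rn j0 jr.
have [d d0 hd] := mutant_generic rn ht.
have [[i a]|d' d'0 hd'] := @uniformly_small R ('I_n'.+1 * 'I_r'.+1)%type
    (fun p e => e * t p.1 ^+ p.2 < t p.1 ^+ r'.+1).
  have tp m : 0 < t i ^+ m by rewrite exprn_gt0.
  have tp1 : 0 < t i ^+ a + 1 by rewrite addr_gt0.
  exists (t i ^+ r'.+1 / (t i ^+ a + 1)); first by rewrite divr_gt0.
  move=> e /andP[e0]; rewrite ler_pdivlMr //= => he; apply: lt_le_trans he.
  by rewrite ltr_pM2l // ltrDl.
pose e := Num.min d d'.
have e0 : 0 < e by rewrite lt_min d0.
have gen e' : `|e'| <= e -> forall lam : 'cV_n'.+1, mutant r' n' j k e' t *m lam = 0 ->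
    (#|supp lam| <= r'.+2)%N -> lam != 0 -> supp lam = low r' n'.
  by move=> he; apply: hd; rewrite (le_trans he) // ge_min lexx.
have small (i : 'I_n'.+1) a : (a < r'.+1)%N -> e * t i ^+ a < t i ^+ r'.+1.
  by move=> ar; apply: (hd' e _ (i, Ordinal ar)); rewrite e0 ge_min lexx orbT.
exists (mut r' n' j k t e true), (mut r' n' j k t e false); split.
- by split; [apply: mut_pointed|apply: mut_general_position].
- by split; [apply: mut_pointed|apply: mut_general_position].
- by move=> x y z; apply: enumerator_mut_sub.
Qed.

(** Points on the moment curve: the first coordinate is 1, and the maximal minors are Vandermonde
    determinants with distinct nodes. *)
Lemma config0_exists (r n : nat) : (0 < r)%N -> exists V : 'M[R]_(r, n), config0 V.
Proof.
move=> r0; pose a : 'rV[R]_n := \row_i (i : nat)%:R; exists (Vandermonde r a); split.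
  exists (fun j : 'I_r => (j == 0%N :> nat)%:R); split.
    by exists (Ordinal r0); rewrite eqxx oner_eq0.
  move=> i; rewrite (bigD1 (Ordinal r0)) //= mxE expr0 mulr1 big1 ?addr0 //.
  by move=> j; rewrite -val_eqE /= => /negbTE ->; rewrite mul0r.
move=> f fi; pose b : 'rV[R]_r := \row_k a 0 (f k).
have -> : colsub f (Vandermonde r a) = Vandermonde r b.
  by apply/matrixP => i k; rewrite !mxE.
rewrite det_Vandermonde; apply/prodf_neq0 => i _; apply/prodf_neq0 => k ik.
rewrite !mxE subr_eq0 eqr_nat val_eqE (inj_eq fi) -val_eqE gtn_eqF //.
Qed.

Variables r n : nat.
Hypothesis r_gt0 : (0 < r)%N.
Hypothesis rn : (r <= n)%N.
Notation gmx := 'M[R]_(r.+1, (n - r).+1).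
Implicit Types (g : gmx) (V W : 'M[R]_(r, n)).

Lemma S_mapD g g' : S_map (g + g') = S_map g + S_map g'.
Proof.
apply: ev_inj => x y; rewrite [LHS](ev_S_map rn) [RHS]evD.
by rewrite [X in _ = X + _](ev_S_map rn) [X in _ = _ + X](ev_S_map rn) gformD opprD.
Qed.

Lemma S_mapZ c g : S_map (c *: g) = c *: S_map g.
Proof.
apply: ev_inj => x y; rewrite (ev_S_map rn) gformZ -mulrN -(ev_S_map rn) /ev mulr_sumr.
apply: eq_bigr => s _; rewrite mulr_sumr; apply: eq_bigr => t _.
by rewrite [in RHS]mxE !mulrA.
Qed.

Lemma S_map0 : S_map (0 : gmx) = 0.
Proof. by rewrite -(scale0r (0 : gmx)) S_mapZ scale0r. Qed.

Lemma S_map_sum (I : finType) (F : I -> gmx) : S_map (\sum_i F i) = \sum_i S_map (F i).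
Proof. exact: (big_morph (@S_map R r n) S_mapD S_map0). Qed.

Lemma S_map_eq0 g : S_map g = 0 -> g = 0.
Proof.
move=> h; apply: gform_eq0 => x y; apply/eqP; rewrite -oppr_eq0 -(ev_S_map rn) h /ev.
by rewrite big1 // => s _; rewrite big1 // => t _; rewrite mxE !mul0r.
Qed.

Lemma G0_sum (I : finType) (F : I -> gmx) (c : I -> R) :
  (forall i, G0 (F i)) -> G0 (\sum_i c i *: F i).
Proof.
move=> h; split=> [j k|k]; rewrite !summxE.
  split; [|split]; rewrite -?sumrN; apply: eq_bigr => i _; rewrite !mxE -?mulrN;
    by have [/(_ j k) [h1 [h2 h3]] _] := h i; congr (_ * _).
by rewrite big1 // => i _; rewrite mxE (h i).2 mulr0.
Qed.

Definition unit_G (j : 'I_r.+1) (k : 'I_(n - r).+1) : gmx :=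
  delta_mx j k - delta_mx j (rev_ord k) - delta_mx (rev_ord j) k + delta_mx (rev_ord j)
    (rev_ord k).

Lemma mutation_unit V0 (j : 'I_r.+1) (k : 'I_(n - r).+1) : config0 V0 -> (0 < j < r)%N ->
  exists V W, [/\ config0 V, config0 W & fstar W - fstar V = S_map (unit_G j k)].
Proof.
move=> c0 /[dup] jr /andP[j0 jr'].
(* For [n = r] there is only [k = 0], which is its own reversal, so [unit_G j k] vanishes and no
   mutation is required. *)
have [enr|nr] := eqVneq n r.
  exists V0, V0; split=> //; rewrite subrr (_ : unit_G j k = 0) ?S_map0 //.
  have -> : unit_G j k = unit_G j (rev_ord k) by rewrite (_ : rev_ord k = k) //;
    apply: val_inj => /=; have := ltn_ord k; lia.
  have ek : rev_ord k = k by apply: val_inj => /=; have := ltn_ord k; lia.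
  by rewrite /unit_G !ek subrr sub0r addNr.
have [||V [W [cV cW h]]] := @exists_mutation r n j k _ jr.
- by rewrite (leq_ltn_trans j0 jr') ltn_neqAle eq_sym nr.
- by rewrite -ltnS.
exists V, W; split=> //; apply/eqP; rewrite subr_eq addrC; apply/eqP.
apply: ev_inj => x y; rewrite [RHS]evD (ev_fstar rn W) (ev_fstar rn V) (ev_S_map rn (unit_G j k)).
have := h x y 1; move/eqP; rewrite subr_eq => /eqP ->.
rewrite /unit_G !gformD -!scaleN1r !gformZ !gform_delta !rev_ord_subn /= !subSS !expr1n; ring.
Qed.

(** The added coefficients [c] and [- c] keep the total equal to 1. *)
Lemma aff_hull_shift m p (X : 'M[R]_(m, p) -> Prop) A P Q c :
  aff_hull X A -> X P -> X Q -> aff_hull X (A + c *: (P - Q)).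
Proof.
move=> [l [B [b [XB [b1 ->]]]]] XP XQ.
exists (2 + l)%N, (fun i => match split i with inl o => if o == 0 then P else Q | inr i' => B
  i' end),
  (fun i => match split i with inl o => if o == 0 then c else - c | inr i' => b i' end).
have sl (o : 'I_2) : split (lshift l o) = inl o by rewrite (unsplitK (inl o)).
have sr (o : 'I_l) : split (rshift 2 o) = inr o by rewrite (unsplitK (inr o)).
split; first by move=> i; case: (split i) => [o|//]; case: ifP.
rewrite !big_split_ord /= !big_ord_recl !big_ord0 !sl /= addr0 addrN add0r.
under eq_bigr do rewrite sr; split=> //.
rewrite addr0 scaleNr scalerBr addrC; congr (_ + _).
by apply: eq_bigr => i _; rewrite sr.
Qed.

Lemma aff_hull_fstarP V0 A : config0 V0 ->
  aff_hull (@fstar_set R r n) A <-> exists g, G0 g /\ A = fstar V0 + S_map g.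
Proof.
move=> c0; split.
  move=> [l [P [c [XP [c1 ->]]]]].
  have ex i : exists g, G0 g /\ P i = fstar V0 + S_map g.
    by have [V [cV ->]] := XP i; have [g gG hg] := fstar_sub rn c0 cV; exists g.
  have [g hg] := choice ex; exists (\sum_i c i *: g i); split.
    by apply: G0_sum => i; have [] := hg i.
  rewrite S_map_sum -[fstar V0]scale1r -c1 scaler_suml -big_split; apply: eq_bigr => i _.
  by have [_ ->] := hg i; rewrite S_mapZ scalerDr.
move=> [g [[gs g0] ->]].
(* By its symmetries [g] equals its average over the four signed index reversals, whence the factor
   4. *)
have gE : g = \sum_j \sum_k (g j k / 4%:R) *: unit_G j k.
  have E0 : \sum_j \sum_k g j k *: delta_mx j k = g by rewrite -matrix_sum_delta.
  have E1 : \sum_j \sum_k g j k *: delta_mx j (rev_ord k) = - g.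
    rewrite -[in RHS]E0 -sumrN; apply: eq_bigr => j _; rewrite sum_rev_ord -sumrN.
    by apply: eq_bigr => k _; rewrite rev_ordK -scaleNr; have [_ [-> _]] := gs j k; rewrite opprK.
  have E2 : \sum_j \sum_k g j k *: delta_mx (rev_ord j) k = - g.
    rewrite -[in RHS]E0 sum_rev_ord -sumrN; apply: eq_bigr => j _; rewrite -sumrN.
    by apply: eq_bigr => k _; rewrite rev_ordK -scaleNr; have [-> _] := gs j k; rewrite opprK.
  have E3 : \sum_j \sum_k g j k *: delta_mx (rev_ord j) (rev_ord k) = g.
    rewrite -[in RHS]E0 sum_rev_ord; apply: eq_bigr => j _; rewrite sum_rev_ord.
    by apply: eq_bigr => k _; rewrite !rev_ordK; have [_ [_ <-]] := gs j k.
  transitivity (4%:R^-1 *: (\sum_j \sum_k g j k *: delta_mx j k - \sum_j \sum_k g j k *: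
    delta_mx j (rev_ord k)
      - \sum_j \sum_k g j k *: delta_mx (rev_ord j) k + \sum_j \sum_k g j k *: delta_mx
        (rev_ord j) (rev_ord k))).
    rewrite E0 E1 E2 E3 !opprK; apply/matrixP => j k; rewrite !mxE; lra.
  rewrite -!sumrN -!big_split scaler_sumr; apply: eq_bigr => j _ /=.
  rewrite -!sumrN -!big_split scaler_sumr; apply: eq_bigr => k _ /=.
  by rewrite /unit_G -!scalerBr -scalerDr scalerA mulrC.
(* Rows 0 and [r], for which no mutation is available, vanish: the former by assumption, the latter
   by symmetry. *)
have gr (j : 'I_r.+1) : (0 < j < r)%N = false -> forall k, g j k = 0.
  move=> jr k; have [j0|j0] := posnP j.
    by rewrite (_ : j = ord0) ?g0 //; apply: val_inj.
  have [-> _] := gs j k; rewrite (_ : rev_ord j = ord0) ?g0 ?oppr0 //; apply: val_inj => /=.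
  by move: jr (ltn_ord j); rewrite j0 /=; lia.
rewrite gE pair_big /= S_map_sum.
elim/big_rec: _ => [|[j k] M _ IH].
  exists 1%N, (fun=> fstar V0), (fun=> 1); split; first by exists V0.
  by rewrite !big_ord1 scale1r addr0.
rewrite [_ + M]addrC addrA S_mapZ /=.
case jr: (0 < j < r)%N; last by rewrite (gr j jr) mul0r scale0r addr0.
have [V [W [cV cW <-]]] := mutation_unit k c0 jr.
by apply: aff_hull_shift => //; [exists W|exists V].
Qed.

(** * Coordinates on the symmetric coefficient matrices and the dimension *)

Definition skew (N a b : nat) : R := (b == a)%:R - (N - b == a)%N%:R.

Lemma skew_sub N a b : (b <= N)%N -> skew N a (N - b) = - skew N a b.
Proof. by move=> bN; rewrite /skew subKn // opprB. Qed.

(** An antisymmetric sequence is determined by its first half, with value 0 at the middle index when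
    [N] is even; the [skew N a] form the corresponding basis. *)
Lemma sum_skew N (phi : nat -> R) c : (c <= N)%N ->
  (forall b, (b <= N)%N -> phi b = - phi (N - b)%N) ->
  \sum_(a < (N + 1)./2) phi a * skew N a c = phi c.
Proof.
move=> cN sk.
have pick (e : nat) : \sum_(a < (N + 1)./2) phi a * (e == a :> nat)%:R = if (e < (N + 1)./2)%N
  then phi e else 0.
  case: ltnP => he; last first.
    by rewrite big1 // => a _; rewrite gtn_eqF ?mulr0 // (leq_trans (ltn_ord a)).
  rewrite (bigD1 (Ordinal he)) //= eqxx mulr1 big1 ?addr0 // => a; rewrite -val_eqE /= => ae.
  by rewrite eq_sym (negbTE ae) mulr0.
under eq_bigr do rewrite mulrBr.
rewrite sumrB !pick; case: ltnP => h1; case: ltnP => h2.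
- lia.
- by rewrite subr0.
- by rewrite sub0r -sk.
- have e : (N - c = c)%N by lia.
  by have := sk c cN; rewrite e subrr; lra.
Qed.

Lemma skew_low N a b : (a + b < N)%N -> skew N a b = (b == a)%:R.
Proof. by move=> h; rewrite /skew (_ : (N - b == a)%N = false) ?subr0 //; apply/eqP; lia. Qed.

Notation d1 := ((r - 1)./2).
Notation d2 := ((n - r + 1)./2).

(** The shift to [a.+1] skips row 0, which vanishes in [G0]. *)
Definition G0_param (h : 'M[R]_(d1, d2)) : gmx :=
  \matrix_(j, k) \sum_a \sum_b h a b * (skew r a.+1 j * skew (n - r) b k).

Lemma G0_paramP h : G0 (G0_param h).
Proof.
have s1 a (j : 'I_r.+1) : skew r a (rev_ord j) = - skew r a j by rewrite /= subSS skew_sub //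
  -ltnS.
have s2 a (k : 'I_(n - r).+1) : skew (n - r) a (rev_ord k) = - skew (n - r) a k.
  by rewrite /= subSS skew_sub // -ltnS.
split=> [j k|k]; last first.
  rewrite mxE big1 // => a _; rewrite big1 // => b _.
  by rewrite skew_low ?mul0r ?mulr0 //; rewrite addn0; have := ltn_ord a; lia.
rewrite !mxE -!sumrN; split; [|split]; apply: eq_bigr => a _; rewrite -?sumrN;
  apply: eq_bigr => b _;
  rewrite ?s1 ?s2; ring.
Qed.

Lemma G0_param_surj g : G0 g -> exists h, g = G0_param h.
Proof.
move=> [gs g0]; exists (\matrix_(a, b) g (inord a.+1) (inord b)).
have rev_inord N c : (c <= N)%N -> rev_ord (inord c : 'I_N.+1) = inord (N - c).
  by move=> cN; apply: val_inj; rewrite /= !inordK ?ltnS ?leq_subr // subSS.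
apply/matrixP => j k; rewrite mxE.
have jr : (j <= r)%N by rewrite -ltnS.
have kn : (k <= n - r)%N by rewrite -ltnS.
transitivity (\sum_(a < d1) g (inord a.+1) k * skew r a.+1 j); last first.
  apply: eq_bigr => a _; rewrite -[in LHS](inord_val k) -(@sum_skew (n - r) (fun c => g (inord
    a.+1) (inord c)) k) //.
    rewrite mulr_suml; apply: eq_bigr => b _; rewrite mxE; ring.
  by move=> b bn; have [_ [-> _]] := gs (inord a.+1) (inord b); rewrite rev_inord.
rewrite -[in LHS](inord_val j) -(@sum_skew r (fun c => g (inord c) k) j) //; last first.
  by move=> b br; have [-> _] := gs (inord b) k; rewrite rev_inord.
(* The extra basis sequence belongs to row 0 and has coefficient zero. *)
have -> : ((r + 1)./2 = d1.+1)%N by lia.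
rewrite big_ord_recl /= (_ : inord 0 = ord0) ?g0 ?mul0r ?add0r //.
by apply: val_inj; rewrite /= inordK.
Qed.

Definition S_param (h : 'M[R]_(d1, d2)) : 'M[R]_(n.+1, n.+1) := S_map (G0_param h).

Lemma S_param_linear : linear S_param.
Proof.
move=> c h h'; rewrite /S_param -S_mapZ -S_mapD; congr S_map; apply/matrixP => j k.
rewrite !mxE mulr_sumr -big_split; apply: eq_bigr => a _; rewrite mulr_sumr -big_split.
by apply: eq_bigr => b _; rewrite !mxE /=; ring.
Qed.

HB.instance Definition _ := GRing.isLinear.Build R _ _ _ S_param S_param_linear.

(** The entries of [G0_param h] at [(a.+1, b)] are those of [h], since both indices lie in the first
    half, where [skew_low] applies. *)
Lemma S_param_inj : injective S_param.
Proof.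
apply: raddf_inj => h /S_map_eq0 h0; apply/matrixP => a b; rewrite mxE.
have an := ltn_ord a; have bn := ltn_ord b.
have ar : (a.+1 < r.+1)%N by lia.
have br : (b < (n - r).+1)%N by lia.
have /matrixP /(_ (Ordinal ar) (Ordinal br)) := h0; rewrite !mxE /= => <-.
rewrite (bigD1 a) //= (bigD1 b) //= !skew_low; [|lia|lia].
rewrite !eqxx !mulr1 !big1 ?addr0 // => [a' na|b' nb].
  rewrite big1 // => b' _; have an' := ltn_ord a'; rewrite skew_low; last lia.
  by rewrite eqSS eq_sym val_eqE (negbTE na) mul0r mulr0.
have bn' := ltn_ord b'; rewrite skew_low; last lia.
by rewrite [b == b' :> nat]eq_sym val_eqE (negbTE nb) !mulr0.
Qed.

(** The hull is a translate of the image of the injective linear map [S_param], so the dimension is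
    that of its domain. *)
Lemma aff_dim_fstar : aff_dim (aff_hull (@fstar_set R r n)) (d1 * d2)%N.
Proof.
have [V0 c0] := config0_exists n r_gt0.
pose L := linfun S_param.
have dimL : \dim (limg L) = (d1 * d2)%N.
  rewrite limg_dim_eq ?dimvf ?dim_matrix //.
  by rewrite (_ : lker L = 0%VS) ?capv0 //; apply/eqP/lker0P => h h'; rewrite !lfunE;
    apply: S_param_inj.
have memL A : aff_hull (@fstar_set R r n) A <-> A - fstar V0 \in limg L.
  split=> [/(aff_hull_fstarP _ c0) [g [/G0_param_surj [h ->] ->]]|/memv_imgP [h _]].
    by rewrite addrAC subrr add0r -[S_map _]/(S_param h) -(lfunE S_param h) memv_img ?memvf.
  rewrite lfunE => /eqP; rewrite subr_eq addrC => /eqP ->.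
  by apply/(aff_hull_fstarP _ c0); exists (G0_param h); split=> //; apply: G0_paramP.
split.
  have szB : size (vbasis (limg L)) == (d1 * d2)%N by rewrite size_tuple dimL.
  exists (fstar V0), (Tuple szB); split; first by apply/memL; rewrite subrr mem0v.
  split=> [b bB|]; last exact: basis_free (vbasisP _).
  by apply/memL; rewrite addrAC subrr add0r; apply: vbasis_mem.
move=> A0 B /memL A0L hB fB; rewrite -dimL; move: fB; rewrite /free => /eqP <-.
apply/dimvS/span_subvP => b /hB /memL; rewrite addrAC => h.
by have := memvB h A0L; rewrite [_ + b]addrC addrK.
Qed.

End Span.

Unset Implicit Arguments.

Theorem theorem1p14 (R : realType) (n r : nat) (hr : (1 <= r)%N) (hrn : (r <= n)%N) :
  aff_dim (aff_hull (@fstar_set R r n)) ((r - 1)./2 * (n - r + 1)./2)%N /\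
  (forall V0 : 'M[R]_(r, n), config0 V0 ->
     forall A : 'M[R]_(n.+1, n.+1),
       aff_hull (@fstar_set R r n) A <->
       exists g : 'M[R]_(r.+1, (n - r).+1), G0 g /\ A = fstar V0 + S_map g).
Proof.
split; first exact: aff_dim_fstar.
by move=> V0 c0 A; apply: aff_hull_fstarP.
Qed.
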